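(* Assume that $A_N=I$, that $\mathcal X_N=\mathbf R^{n_N}$, that $f_N$ is differentiable with $\nabla f_N$ Lipschitz continuous with constant $L$, that $\gamma>\sqrt2L$, that $\inf_{x_i\in\mathcal X_i}f_i(x_i)\ge f_i^*>-\infty$ for $i=1,\ldots,N$, that $f_i+\mathbf 1_{\mathcal X_i}$ is coercive for $i=1,\ldots,N-1$, and that $\mathcal L_\gamma$ is a KL function. Let $\{(x_1^k,\ldots,x_N^k,\lambda^k)\}_{k\ge0}$ be generated by the multi-block ADMM with penalty parameter $\gamma$. For any integer $t>0$ define $$\bar x_i^t=\frac1{t+1}\sum_{k=0}^t x_i^{k+1}\quad(i=1,\ldots,N),\qquad \bar u^t=(\bar x_1^t,\ldots,\bar x_N^t),\qquad\bar\lambda^t=\frac1{t+1}\sum_{k=0}^t\lambda^{k+1}.$$ For any $(u^*,\lambda^* )\in\Omega^*$, with $u^*=(x_1^*,\ldots,x_N^* )$ and $\rho:=\|\lambda^*\|+1$, there exist finite constants $D,G>0$, independent of $t$, such that for every integer $t>0$ $$0\le f(\bar u^t)-f(u^* )+\rho\Big\|\sum_{i=1}^N A_i\bar x_i^t-b\Big\|\le\frac{\rho^2+\|\lambda^0\|^2}{\gamma(t+1)}+\frac{\gamma}{2(t+1)}\Big\|\sum_{i=2}^{N-1}A_i(x_i^0-x_i^* )+(x_N^0-x_N^* )\Big\|^2+\frac{\gamma DG}{t+1}.$$ Consequently, when $t$ is of order $1/\epsilon$, $\bar u^t$ is an $\epsilon$-optimal solution of the problem: for every constant $c>0$ there is a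 constant $C$, independent of $\epsilon$ and $t$, such that for every $\epsilon>0$ and every integer $t\ge c/\epsilon$, $t>0$, $$|f(\bar u^t)-f(u^* )|\le C\epsilon\qquad\text{and}\qquad\Big\|\sum_{i=1}^N A_i\bar x_i^t-b\Big\|\le C\epsilon .$$
   Context: Let $N\ge3$. The problem is $$\min\ f_1(x_1)+\cdots+f_N(x_N)\quad\text{s.t. }A_1x_1+\cdots+A_Nx_N=b,\ x_i\in\mathcal X_i,\ i=1,\ldots,N,$$ where $A_i\in\mathbf R^{p\times n_i}$, $b\in\mathbf R^p$, $\mathcal X_i\subset\mathbf R^{n_i}$ are closed convex sets and $f_i:\mathbf R^{n_i}\to\mathbf R$ are closed convex functions. Write $u=(x_1,\ldots,x_N)$, $f(u)=\sum_i f_i(x_i)$, $w=(u,\lambda)$, $\|\cdot\|$ for the Euclidean norm, and $\mathbf 1_{\mathcal X}$ for the indicator function of $\mathcal X$ ($0$ on $\mathcal X$, $+\infty$ elsewhere). Let $\Omega=\mathcal X_1\times\cdots\times\mathcal X_N\times\mathbf R^p$ and let $\Omega^*$ be the set of $(x_1^*,\ldots,x_N^*,\lambda^* )\in\Omega$ such that $\sum_i A_ix_i^*=b$ and, for each $i$, there is a subgradient $g_i(x_i^* )\in\partial f_i(x_i^* )$ with $(x_i-x_i^* )^\top(g_i(x_i^* )-A_i^\top\lambda^* )\ge0$ for all $x_i\in\mathcal X_i$. It is assumed that $\Omega^*\ne\emptyset$. Augmented Lagrangian ($\gamma>0$): $$\mathcal L_\gamma(x_1,\ldots,x_N;\lambda)=\sum_{j=1}^N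 f_j(x_j)-\Big\langle\lambda,\sum_{j=1}^N A_jx_j-b\Big\rangle+\frac\gamma2\Big\|\sum_{j=1}^N A_jx_j-b\Big\|^2 .$$ Multi-block ADMM: starting from $w^0=(x_1^0,\ldots,x_N^0,\lambda^0)$, for $k=0,1,\ldots$ and $i=1,\ldots,N$ in order, $$x_i^{k+1}\in\mathop{\rm argmin}_{x_i\in\mathcal X_i}\mathcal L_\gamma(x_1^{k+1},\ldots,x_{i-1}^{k+1},x_i,x_{i+1}^k,\ldots,x_N^k;\lambda^k),$$ then $\lambda^{k+1}=\lambda^k-\gamma\big(\sum_{j=1}^N A_jx_j^{k+1}-b\big)$. Subdifferential of $\mathcal L_\gamma$: $\mathcal L_\gamma$ is regarded as a function on $\Omega$ (equivalently, extended by $+\infty$ outside $\Omega$), and $\partial\mathcal L_\gamma(w)$ is the set of vectors with $x_i$-component $g_i-A_i^\top\lambda+\gamma A_i^\top(\sum_jA_jx_j-b)$, $g_i\in\partial(f_i+\mathbf 1_{\mathcal X_i})(x_i)$, for $i=1,\ldots,N$, and $\lambda$-component $b-\sum_jA_jx_j$. KL functions: for $\eta\in(0,+\infty]$ let $\Phi_\eta$ be the class of concave continuous $\varphi:[0,\eta)\to\mathbf R_+$ with $\varphi(0)=0$, $\varphi$ is $C^1$ on $(0,\eta)$, and $\varphi'(s)>0$ for all $s\in(0,\eta)$. A proper lower semicontinuous $h:\Omega\to(-\infty,+\infty]$ has the KL property at $w_0\in\{w\in\Omega:\partial h(w)\ne\emptyset\}$ if there exist $\eta\in(0,+\infty]$,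 a neighbourhood $W_0$ of $w_0$ and $\varphi\in\Phi_\eta$ such that $\varphi'(h(\bar w)-h(w_0))\,\mathrm{dist}(0,\partial h(\bar w))\ge1$ for all $\bar w\in W_0\cap\{w\in\Omega:h(w_0)<h(w)<h(w_0)+\eta\}$, where $\mathrm{dist}(x,S)=\inf\{\|y-x\|:y\in S\}$. $h$ is a KL function if it has the KL property at each point of $\{w\in\Omega:\partial h(w)\ne\emptyset\}$. *)

(* Defs.v *)
From HB Require Import structures.
From mathcomp Require Import all_boot all_order all_algebra.
From mathcomp Require Import all_classical all_reals all_analysis.

Set Implicit Arguments.
Unset Strict Implicit.
Unset Printing Implicit Defensive.

Import Order.TTheory GRing.Theory Num.Theory.
Import numFieldNormedType.Exports.

Local Open Scope classical_set_scope.
Local Open Scope ring_scope.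

(* The library norm on matrices is the max norm, hence the explicit Euclidean
   norm. Both induce the same topology, so [closed] and [differentiable] keep
   their library meaning. *)
Section euclidean.
Context {R : realType}.

Definition dot d (x y : 'cV[R]_d) : R := \sum_j x j 0 * y j 0.

Definition enorm d (x : 'cV[R]_d) : R := Num.sqrt (dot x x).

Definition grad d (f : 'cV[R]_d -> R) (x : 'cV[R]_d) : 'cV[R]_d :=
  \col_j 'd f x (delta_mx j 0).

End euclidean.

Section convex_analysis.
Context {R : realType}.
Local Open Scope ereal_scope.

Definition indicator (T : Type) (S : set T) (x : T) : \bar R :=
  if x \in S then 0 else +oo.

Definition extend (T : Type) (S : set T) (f : T -> R) (x : T) : \bar R :=
  (f x)%:E + indicator S x.

Definition argmin (T : Type) (S : set T) (f : T -> R) : set T :=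
  [set x | S x /\ forall y, S y -> (f x <= f y)%R].

Definition closed_function d (f : 'cV[R]_d -> R) : Prop :=
  closed [set xa : 'cV[R]_d * R | (f xa.1 <= xa.2)%R].

(* Empty outside the effective domain. *)
Definition subdiff d (h : 'cV[R]_d -> \bar R) (x : 'cV[R]_d) :
    set 'cV[R]_d :=
  [set g | h x \is a fin_num /\
           forall y, h x + (dot g (y - x))%:E <= h y].

Definition coercive d (h : 'cV[R]_d -> \bar R) : Prop :=
  forall M : R, exists r : R,
    forall x, (r <= enorm x)%R -> M%:E <= h x.

End convex_analysis.

Section KL.
Context {R : realType} {N : nat} {n : 'I_N -> nat} {p : nat}.
Local Open Scope ereal_scope.

(* Points w = (u, lambda) with u = (x_1, ..., x_N). *)
Definition wspace : Type := ((forall i, 'cV[R]_(n i)) * 'cV[R]_p)%type.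

Definition wnorm (w : wspace) : R :=
  Num.sqrt ((\sum_i enorm (w.1 i) ^+ 2) + enorm w.2 ^+ 2)%R.

Definition wsub (w w' : wspace) : wspace :=
  (fun i => (w.1 i - w'.1 i)%R, (w.2 - w'.2)%R).

Definition wnbhs (w0 : wspace) (W : set wspace) : Prop :=
  exists2 r : R, (0 < r)%R & forall w, (wnorm (wsub w w0) < r)%R -> W w.

Definition proper (h : wspace -> \bar R) : Prop :=
  (forall w, -oo < h w) /\ exists w, h w < +oo.

Definition lsc (h : wspace -> \bar R) : Prop :=
  forall (w : wspace) (a : R), a%:E < h w ->
    exists2 W, wnbhs w W & forall w', W w' -> a%:E < h w'.

(* dist(0, S), equal to +oo when S is empty. *)
Definition dist0 (S : set wspace) : \bar R :=
  ereal_inf [set (wnorm v)%:E | v in S].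

(* The class Phi_eta; only the values of phi on [0, eta) matter. *)
Definition desingularizing (eta : \bar R) (phi : R -> R) : Prop :=
  let D := [set s : R | (0 <= s)%R /\ s%:E < eta] in
  [/\ convex_function (D : set R^o) (fun s : R^o => - phi s)%R,
      {within D, continuous phi},
      (forall s, D s -> (0 <= phi s)%R),
      phi 0%R = 0%R
    & forall s, (0 < s)%R -> s%:E < eta ->
        [/\ derivable phi s 1%R, {for s, continuous phi^`()%classic}
          & (0 < phi^`()%classic s)%R]].

(* [dh w] is the subdifferential of [h] at [w]. *)
Definition KL_at (h : wspace -> \bar R) (dh : wspace -> set wspace)
    (w0 : wspace) : Prop :=
  exists (eta : \bar R) (W0 : set wspace) (phi : R -> R),
    [/\ 0 < eta, wnbhs w0 W0, desingularizing eta phi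
      & forall w, W0 w -> h w0 < h w -> h w < h w0 + eta ->
          1 <= (phi^`()%classic (fine (h w - h w0)))%:E * dist0 (dh w)].

Definition KL_function (h : wspace -> \bar R) (dh : wspace -> set wspace) :
    Prop :=
  [/\ proper h, lsc h & forall w0, dh w0 !=set0 -> KL_at h dh w0].

End KL.

Section multiblock.
Context {R : realType} {N : nat} {n : 'I_N -> nat} {p : nat}.
Variables (A : forall i, 'M[R]_(p, n i)) (b : 'cV[R]_p).
Variables (X : forall i, set 'cV[R]_(n i)) (f : forall i, 'cV[R]_(n i) -> R).
Implicit Types (u : forall i, 'cV[R]_(n i)) (lam : 'cV[R]_p).

Let W := @wspace R N n p.

Definition objective u : R := \sum_i f (u i).

Definition residual u : 'cV[R]_p := (\sum_i A i *m u i) - b.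

Definition Omega : set W := [set w | forall i, X (w.1 i)].

Definition Omega_star : set W :=
  [set w | [/\ Omega w, \sum_i A i *m w.1 i = b
    & forall i, exists2 g, subdiff (EFin \o @f i) (w.1 i) g &
        forall xi, X xi ->
          0 <= dot (xi - w.1 i) (g - (A i)^T *m w.2)]].

Definition auglag (gamma : R) u lam : R :=
  objective u - dot lam (residual u) + gamma / 2 * enorm (residual u) ^+ 2.

Definition auglag_ext (gamma : R) : W -> \bar R :=
  extend Omega (fun w => auglag gamma w.1 w.2).

Definition subdiff_auglag (gamma : R) (w : W) : set W :=
  [set v | (forall i, exists2 g, subdiff (extend (@X i) (@f i)) (w.1 i) g &
              v.1 i = g - (A i)^T *m w.2
                      + gamma *: ((A i)^T *m residual w.1)) /\
           v.2 = b - \sum_i A i *m w.1 i].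

Definition multiblock_ADMM (gamma : R) (x : nat -> forall i, 'cV[R]_(n i))
    (lam : nat -> 'cV[R]_p) : Prop :=
  forall k,
    (forall i, argmin (@X i)
      (fun xi => auglag gamma
         (@dfwith _ (fun j => 'cV[R]_(n j))
            (fun j => if (j < i)%N then x k.+1 j else x k j) i xi)
         (lam k))
      (x k.+1 i)) /\
    lam k.+1 = lam k - gamma *: residual (x k.+1).

End multiblock.

Definition average {R : realType} {N : nat} {n : 'I_N -> nat}
    (x : nat -> forall i, 'cV[R]_(n i)) (t : nat) (i : 'I_N) : 'cV[R]_(n i) :=
  t.+1%:R^-1 *: \sum_(k < t.+1) x k.+1 i.

(* Main.v *)
Require Import Defs.
From HB Require Import structures.
From mathcomp Require Import all_boot all_order all_algebra.
From mathcomp Require Import all_classical all_reals all_analysis.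
From mathcomp Require Import ring lra.

(* Summing the optimality inequalities of the blocks against a solution gives an
   O(1/t) gap for the averages up to the cross terms
   gamma * <sum_(j > i) A_j (x_j^k - x_j^(k+1)), A_i (x_i^* - x_i^(k+1))>, so it
   suffices that the iterates are bounded and that the increments
   |A_j (x_j^k - x_j^(k+1))| are summable over k.

   Since A_N is the identity and f_N is smooth, lam^k = grad f_N (x_N^k) from the
   first iteration on, hence |lam^(k+1) - lam^k| <= L |x_N^(k+1) - x_N^k|. With
   gamma > sqrt 2 * L the augmented Lagrangian then decreases by a multiple of the
   squared increment and is bounded below; coercivity bounds the iterates.

   Summability comes from the KL inequality. The x_i^k themselves need not have
   vanishing increments, so the sequence may have many cluster points and the KL
   inequality has to be used uniformly near all of them. Call a set of indices good
   if the KL recursion holds along it for some nonincreasing potential; good sets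
   form an ideal. If the set of all indices were not good, an ultrafilter would
   avoid every good set; the iterates converge along it to a critical point, and
   the KL inequality at that point produces a good set in the ultrafilter. *)

Set Implicit Arguments.
Unset Strict Implicit.
Unset Printing Implicit Defensive.

Import Order.TTheory GRing.Theory Num.Theory.
Import numFieldNormedType.Exports.

Local Open Scope classical_set_scope.
Local Open Scope ring_scope.

(** * The Euclidean inner product *)

Section euclidean_lemmas.
Context {R : realType}.
Implicit Types d : nat.

Lemma dotC d (x y : 'cV[R]_d) : dot x y = dot y x.
Proof. by apply: eq_bigr => j _; rewrite mulrC. Qed.

Lemma dotDl d (x y z : 'cV[R]_d) : dot (x + y) z = dot x z + dot y z.
Proof.
by rewrite /dot -big_split; apply: eq_bigr => j _; rewrite mxE mulrDl.
Qed.

Lemma dotZl d a (x y : 'cV[R]_d) : dot (a *: x) y = a * dot x y.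
Proof. by rewrite /dot mulr_sumr; apply: eq_bigr => j _; rewrite mxE mulrA. Qed.

Lemma dotNl d (x y : 'cV[R]_d) : dot (- x) y = - dot x y.
Proof. by rewrite -scaleN1r dotZl mulN1r. Qed.

Lemma dotDr d (x y z : 'cV[R]_d) : dot z (x + y) = dot z x + dot z y.
Proof. by rewrite dotC dotDl !(dotC z). Qed.

Lemma dotZr d a (x y : 'cV[R]_d) : dot x (a *: y) = a * dot x y.
Proof. by rewrite dotC dotZl dotC. Qed.

Lemma dotNr d (x y : 'cV[R]_d) : dot x (- y) = - dot x y.
Proof. by rewrite dotC dotNl dotC. Qed.

Lemma dot0l d (x : 'cV[R]_d) : dot 0 x = 0.
Proof. by rewrite -(scale0r 0) dotZl mul0r. Qed.

Lemma dot0r d (x : 'cV[R]_d) : dot x 0 = 0.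
Proof. by rewrite dotC dot0l. Qed.

Definition dotE := (dotDl, dotDr, dotNl, dotNr, dotZl, dotZr).

Lemma dot_suml d (I : Type) (r : seq I) (P : pred I) (F : I -> 'cV[R]_d) y :
  dot (\sum_(i <- r | P i) F i) y = \sum_(i <- r | P i) dot (F i) y.
Proof. by elim/big_ind2 : _ => [|u a v c <- <-|//]; rewrite ?dot0l ?dotDl. Qed.

Lemma dot_sumr d (I : Type) (r : seq I) (P : pred I) (F : I -> 'cV[R]_d) y :
  dot y (\sum_(i <- r | P i) F i) = \sum_(i <- r | P i) dot y (F i).
Proof. by rewrite dotC dot_suml; apply: eq_bigr => i _; rewrite dotC. Qed.

Lemma dot_mulmx d e (A : 'M[R]_(e, d)) x y :
  dot (A *m x) y = dot x (A^T *m y).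
Proof.
have dot_mx k (u v : 'cV[R]_k) : dot u v = (u^T *m v) 0 0.
  by rewrite /dot mxE; apply: eq_bigr => j _; rewrite mxE.
by rewrite !dot_mx trmx_mul mulmxA.
Qed.

Lemma dotxx_ge0 d (x : 'cV[R]_d) : 0 <= dot x x.
Proof. by apply: sumr_ge0 => j _; rewrite -expr2 sqr_ge0. Qed.

Lemma enorm_ge0 d (x : 'cV[R]_d) : 0 <= enorm x.
Proof. exact: sqrtr_ge0. Qed.

Lemma enorm_sqr d (x : 'cV[R]_d) : enorm x ^+ 2 = dot x x.
Proof. by rewrite sqr_sqrtr ?dotxx_ge0. Qed.

Lemma enorm0 d : enorm (0 : 'cV[R]_d) = 0.
Proof. by rewrite /enorm dot0l sqrtr0. Qed.

Lemma enormZ d a (x : 'cV[R]_d) : enorm (a *: x) = `|a| * enorm x.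
Proof. by rewrite /enorm !dotE mulrA -expr2 sqrtrM ?sqr_ge0 // sqrtr_sqr. Qed.

Lemma enormN d (x : 'cV[R]_d) : enorm (- x) = enorm x.
Proof. by rewrite -scaleN1r enormZ normrN1 mul1r. Qed.

Lemma enorm_coord d (x : 'cV[R]_d) j : `|x j 0| <= enorm x.
Proof.
rewrite -ler_sqr ?nnegrE ?enorm_ge0 // enorm_sqr /dot (bigD1 j) //= real_normK ?num_real //.
by rewrite expr2 lerDl sumr_ge0 // => i _; rewrite -expr2 sqr_ge0.
Qed.

Lemma enorm_eq0 d (x : 'cV[R]_d) : enorm x = 0 -> x = 0.
Proof.
move=> x0; apply/matrixP => j k; rewrite ord1 mxE; apply/eqP.
by rewrite -normr_le0 -x0 enorm_coord.
Qed.

(* The discriminant argument: |b x - a y|^2 >= 0 with a = |x|, b = |y|. *)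
Lemma cauchy_schwarz d (x y : 'cV[R]_d) : dot x y <= enorm x * enorm y.
Proof.
have [/enorm_eq0->|x0] := eqVneq (enorm x) 0; first by rewrite enorm0 dot0l mul0r.
have [/enorm_eq0->|y0] := eqVneq (enorm y) 0; first by rewrite enorm0 dot0r mulr0.
have xy0 : 0 < enorm x * enorm y by rewrite mulr_gt0 // lt_neqAle enorm_ge0 eq_sym ?x0 ?y0.
have := dotxx_ge0 (enorm y *: x - enorm x *: y).
rewrite !dotE (dotC y x) -!enorm_sqr => h.
rewrite -(ler_pM2l xy0); lra.
Qed.

Lemma ler_dot_norm d (x y : 'cV[R]_d) : `|dot x y| <= enorm x * enorm y.
Proof.
rewrite ler_norml cauchy_schwarz andbT lerNl -dotNl.
by rewrite -(enormN x) cauchy_schwarz.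
Qed.

Lemma ler_enormD d (x y : 'cV[R]_d) : enorm (x + y) <= enorm x + enorm y.
Proof.
rewrite -ler_sqr ?nnegrE ?addr_ge0 ?enorm_ge0 // enorm_sqr !dotE (dotC y x).
rewrite sqrrD -!enorm_sqr; have := cauchy_schwarz x y; lra.
Qed.

Lemma ler_enormB d (x y : 'cV[R]_d) : enorm (x - y) <= enorm x + enorm y.
Proof. by rewrite -(enormN y) ler_enormD. Qed.

Lemma ler_enorm_sum d (I : Type) (r : seq I) (P : pred I) (F : I -> 'cV[R]_d) :
  enorm (\sum_(i <- r | P i) F i) <= \sum_(i <- r | P i) enorm (F i).
Proof.
elim/big_ind2 : _ => [|u a v c ua vc|//]; first by rewrite enorm0.
exact: le_trans (ler_enormD _ _) (lerD ua vc).
Qed.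

Lemma ler_enorm_coord_sum d (x : 'cV[R]_d) : enorm x <= \sum_j `|x j 0|.
Proof.
have {1}-> : x = \sum_j x j 0 *: delta_mx j 0.
  apply/matrixP => j k; rewrite ord1 summxE (bigD1 j) //= !mxE !eqxx mulr1.
  by rewrite big1 ?addr0 // => i ij; rewrite !mxE eq_sym (negPf ij) mulr0.
apply: le_trans (ler_enorm_sum _ _ _) _; apply: ler_sum => j _.
rewrite enormZ /enorm /dot (bigD1 j) //= !mxE !eqxx mulr1 big1 ?addr0 ?sqrtr1 ?mulr1 //.
by move=> i ij; rewrite !mxE (negPf ij) mul0r.
Qed.

Lemma mulmx_bounded d e (A : 'M[R]_(e, d)) :
  exists2 C, 0 <= C & forall x, enorm (A *m x) <= C * enorm x.
Proof.
exists (\sum_i \sum_j `|A i j|) => [|x].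
  by apply: sumr_ge0 => i _; apply: sumr_ge0.
apply: le_trans (ler_enorm_coord_sum _) _; rewrite mulr_suml ler_sum // => i _.
rewrite mxE mulr_suml; apply: le_trans (ler_norm_sum _ _ _) _.
by apply: ler_sum => j _; rewrite normrM ler_wpM2l ?enorm_coord.
Qed.

(** Eliminating the dimension equality once turns the cast form of $A_N=I$ into two cast-free
    equations, the form in which the last block is handled afterwards. *)
Lemma mulmx_trmx_isometry d e (A : 'M[R]_(e, d)) (de : d = e) :
  castmx (erefl e, de) A = 1%:M -> A *m A^T = 1%:M /\ A^T *m A = 1%:M.
Proof. by case: e / de A => A; rewrite castmx_id => ->; rewrite trmx1 mul1mx. Qed.

Lemma enorm_mulmx_isometry d e (A : 'M[R]_(e, d)) x :
  A^T *m A = 1%:M -> enorm (A *m x) = enorm x.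
Proof. by move=> AA; rewrite /enorm dot_mulmx mulmxA AA mul1mx. Qed.

End euclidean_lemmas.

(** * Convex functions and gradients *)

Section slopes.
Context {R : realType}.

(** The limit is taken from the right only, so a bound for [0 < t < 1] suffices, which is what
    convexity along a segment provides. *)
Lemma derive_ge_slope (V : normedModType R) (f : V -> R) (x v : V) (c : R) :
  derivable f x v ->
  (forall t, 0 < t -> t < 1 -> t * c <= f (x + t *: v) - f x) ->
  c <= 'D_v f x.
Proof.
move=> df slope; rewrite /derive cvg_at_rightE //.
apply: limr_ge.
  by move/cvg_ex: df => [l fl]; apply/cvg_ex; exists l; exact: cvg_dnbhs_at_right.
near=> t; have t0 : 0 < t by near: t; exact: nbhs_right_gt.
rewrite /= [_ + x]addrC -[c]mul1r -(mulVf (lt0r_neq0 t0)) -mulrA.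
by rewrite ler_wpM2l ?invr_ge0 ?(ltW t0) // slope //; near: t; exact: nbhs_right_lt.
Unshelve. all: by end_near. Qed.

Lemma derive_le_slope (V : normedModType R) (f : V -> R) (x v : V) (c : R) :
  derivable f x v ->
  (forall t, 0 < t -> t < 1 -> f (x + t *: v) - f x <= t * c) ->
  'D_v f x <= c.
Proof.
move=> df slope; rewrite -lerN2 -deriveN //; apply: derive_ge_slope.
  exact: derivableN.
by move=> t t0 t1 /=; rewrite mulrN -opprD lerN2 slope.
Qed.

Lemma ge0_of_vanishing_slope (a q : R) : 0 <= q ->
  (forall t, 0 < t -> t < 1 -> 0 <= a + t * q) -> 0 <= a.
Proof.
move=> q0 aq; apply/ler_addgt0Pr => e e0.
have d0 : 0 < e + q + 1 by lra.
(* This [t] lies strictly between 0 and 1 and makes [t * q <= e]. *)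
have := aq (e / (e + q + 1)); rewrite divr_gt0 // ltr_pdivrMr // mul1r.
move=> /(_ isT) ae; apply: le_trans (ae _) _; first lra.
rewrite lerD2l mulrAC ler_pdivrMr // ler_wpM2l ?(ltW e0) //; lra.
Qed.

End slopes.

(** * Convexity and running averages *)

Section convexity.
Context {R : realType}.
Implicit Types V : lmodType R.

Lemma convex_setP V (X : set V) x y (t : R) : convex_set X ->
  X x -> X y -> 0 <= t -> t <= 1 -> X (t *: x + (1 - t) *: y).
Proof.
move=> convX Xx Xy t0 t1; apply/set_mem.
by apply: (convX x y (Itv01 t0 t1)); apply/mem_set.
Qed.

Lemma convex_functionP V (D : set V) (f : V -> R) x y (t : R) : convex_function D f ->
  D x -> D y -> 0 <= t -> t <= 1 ->
  f (t *: x + (1 - t) *: y) <= t * f x + (1 - t) * f y.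
Proof.
by move=> convf Dx Dy t0 t1; apply: (convf (Itv01 t0 t1)); apply/mem_set.
Qed.

(** A running average is a convex combination of its newest term and the previous average; two-point
    convexity then extends to averages by induction. *)
Lemma avgS V (u : nat -> V) (t : nat) :
  t.+2%:R^-1 *: \sum_(k < t.+2) u k =
  t.+2%:R^-1 *: u t.+1 + (1 - t.+2%:R^-1) *: (t.+1%:R^-1 *: \sum_(k < t.+1) u k) :> V.
Proof.
rewrite big_ord_recr /= scalerDr addrC scalerA; congr (_ + _ *: _).
by rewrite -[t.+2]addn1 natrD; field; rewrite nat1r natr1 !pnatr_eq0.
Qed.

Lemma convex_set_avg V (X : set V) (u : nat -> V) (t : nat) : convex_set X ->
  (forall k, X (u k)) -> X (t.+1%:R^-1 *: \sum_(k < t.+1) u k).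
Proof.
move=> convX Xu; elim: t => [|t IH]; first by rewrite big_ord1 invr1 scale1r.
rewrite avgS; apply: convex_setP => //; rewrite ?invr_ge0 ?ler0n //.
by rewrite invf_le1 ?ltr0n // ler1n.
Qed.

Lemma convex_function_avg V (f : V -> R) (u : nat -> V) (t : nat) :
  convex_function setT f ->
  f (t.+1%:R^-1 *: \sum_(k < t.+1) u k) <= t.+1%:R^-1 * \sum_(k < t.+1) f (u k).
Proof.
move=> convf; elim: t => [|t IH]; first by rewrite !big_ord1 invr1 scale1r mul1r.
have t1 : t.+2%:R^-1 <= 1 :> R by rewrite invf_le1 ?ltr0n // ler1n.
rewrite avgS; apply: le_trans (convex_functionP convf _ _ _ _) _ => //.
have := avgS (V := R^o) (f \o u) t; rewrite /GRing.scale /= => ->.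
by rewrite lerD2l ler_wpM2l // subr_ge0.
Qed.

End convexity.

(** * Gradients, subgradients and first-order optimality *)

Section gradients.
Context {R : realType} {d : nat}.
Implicit Types f : 'cV[R]_d -> R.

Lemma dot_grad f x v : differentiable f x -> dot (grad f x) v = 'D_v f x.
Proof.
move=> df; rewrite deriveE //.
have {2}-> : v = \sum_j v j 0 *: delta_mx j 0.
  apply/matrixP => j k; rewrite ord1 summxE (bigD1 j) //= !mxE !eqxx mulr1.
  by rewrite big1 ?addr0 // => i ij; rewrite !mxE eq_sym (negPf ij) mulr0.
rewrite linear_sum; apply: eq_bigr => j _.
by rewrite linearZ /= mxE mulrC.
Qed.

Lemma convex_grad_ineq f x y : convex_function setT f -> differentiable f x ->
  f x + dot (grad f x) (y - x) <= f y.
Proof.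
move=> convf df; rewrite -lerBrDl dot_grad //; apply: derive_le_slope.
  exact: diff_derivable.
move=> t t0 t1; have := @convex_functionP _ _ _ f y x t convf I I (ltW t0) (ltW t1).
have -> : t *: y + (1 - t) *: x = x + t *: (y - x).
  by rewrite scalerBl scale1r scalerBr addrCA addrC.
lra.
Qed.

(** Testing the subgradient inequality along [g - grad f x] bounds the squared length of that
    direction by zero. *)
Lemma subgradient_unique f x g : differentiable f x ->
  (forall y, f x + dot g (y - x) <= f y) -> g = grad f x.
Proof.
move=> df sub; apply/eqP; rewrite -subr_eq0; apply/eqP/enorm_eq0/eqP.
rewrite -(@eqrXn2 _ 2) ?enorm_ge0 // expr0n /= eq_le sqr_ge0 andbT enorm_sqr.
have -> u : dot (g - grad f x) u = dot g u - dot (grad f x) u.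
  by move: (grad f x) => g'; rewrite dotDl dotNl.
rewrite subr_le0 dot_grad //.
apply: derive_ge_slope => [|t t0 _]; first exact: diff_derivable.
by have := sub (x + t *: (g - grad f x)); rewrite addrAC subrr add0r dotZr; lra.
Qed.

(* Three steps along the segment already bring the constant below [1 / Num.sqrt 2];
   only the gradient inequality for convex functions is used. *)
Lemma convex_descent f L x y : convex_function setT f ->
  (forall z, differentiable f z) ->
  (forall y z, enorm (grad f y - grad f z) <= L * enorm (y - z)) ->
  f y <= f x + dot (grad f x) (y - x) + 2 / 3 * L * enorm (y - x) ^+ 2.
Proof.
move=> convf df lipf.
(* The gradient inequality at the new point [z] looks back to the previous one, and the Lipschitz
   bound trades [grad f z] for [grad f x]. With [s] equal to 0, 1/3 and 2/3 the constants add up to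
   [1/3 * (1/3 + 2/3 + 1) = 2/3]. *)
have step h s : 0 <= s -> f (x + (s + 3^-1) *: h) <=
    f (x + s *: h) + 3^-1 * dot (grad f x) h + 3^-1 * (s + 3^-1) * L * enorm h ^+ 2.
  move=> s0; have [z zE] : exists z, z = x + (s + 3^-1) *: h by eexists.
  rewrite -zE; have := convex_grad_ineq (x + s *: h) convf (df z).
  have -> : x + s *: h - z = (- 3^-1) *: h.
    by rewrite zE scalerDl scaleNr opprD addrACA subrr add0r opprD addrA subrr add0r.
  have zx : z - x = (s + 3^-1) *: h by rewrite zE addrAC subrr add0r.
  have := ler_wpM2r (enorm_ge0 h) (lipf z x).
  have := cauchy_schwarz (grad f z - grad f x) h.
  rewrite zx enormZ ger0_norm; last by rewrite addr_ge0 // invr_ge0 ler0n.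
  move: (grad f z) (grad f x) => g g'; rewrite dotZr dotDl dotNl; lra.
have s1 : 0 <= 3^-1 :> R by rewrite invr_ge0.
have := step (y - x) 0 (lexx 0); have := step (y - x) _ s1.
have := step (y - x) _ (addr_ge0 s1 s1).
rewrite scale0r addr0 add0r (_ : 3^-1 + 3^-1 + 3^-1 = 1); last lra.
by rewrite scale1r addrCA subrr addr0; lra.
Qed.

(** Comparing [x] with [x + t *: (y - x)], bounding [f] there by convexity and dividing by [t]
    leaves a remainder of order [t]. *)
Lemma argmin_quadratic_ineq p (X : set 'cV[R]_d) f (A : 'M[R]_(p, d)) l c gamma x :
  0 <= gamma -> convex_set X -> convex_function setT f ->
  argmin X (fun y => f y - dot l (A *m y + c) + gamma / 2 * enorm (A *m y + c) ^+ 2) x ->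
  forall y, X y -> f x + dot (l - gamma *: (A *m x + c)) (A *m (y - x)) <= f y.
Proof.
move=> gamma0 convX convf [Xx xmin] y Xy; rewrite -subr_ge0.
apply: (@ge0_of_vanishing_slope _ _ (gamma / 2 * enorm (A *m (y - x)) ^+ 2)).
  by rewrite mulr_ge0 ?sqr_ge0 // divr_ge0.
move=> t t0 t1; have := xmin _ (convex_setP convX Xy Xx (ltW t0) (ltW t1)).
have := @convex_functionP _ _ _ f y x t convf I I (ltW t0) (ltW t1).
have -> : t *: y + (1 - t) *: x = x + t *: (y - x).
  by rewrite scalerBl scale1r scalerBr addrCA addrC.
rewrite mulmxDr -scalemxAr; move: (A *m x) (A *m (y - x)) => u v.
rewrite !enorm_sqr !dotE (dotC v u) (dotC v c) => h1 h2.
rewrite -(pmulr_rge0 _ t0); lra.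
Qed.

End gradients.

(** * The KL recursion and limits along ultrafilters *)

Section kl_sums.
Context {R : realType}.
Implicit Types (delta psi : nat -> R) (S : set nat).

(** A concave function lies below its tangent at [s]; only the derivative at [s > 0] enters, so
    [s' = 0] is allowed. *)
Lemma desingularizing_slope (eta : \bar R) (phi : R -> R) s s' :
  desingularizing eta phi -> 0 <= s' -> s' <= s -> 0 < s -> (s%:E < eta)%E ->
  phi^`()%classic s * (s - s') <= phi s - phi s'.
Proof.
move=> [conc _ _ _ dphi] s'0 s's s0 s_eta; have [phis _ _] := dphi _ s0 s_eta.
suff : phi s' - phi s <= 'D_(s' - s) phi s.
  rewrite deriveE; last exact/derivable1_diffP.
  rewrite diff1E; last exact/derivable1_diffP.
  by rewrite /= /GRing.scale /=; lra.
apply: derive_ge_slope.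
  by apply: diff_derivable; exact/derivable1_diffP.
move=> t t0 t1; have D u : 0 <= u -> u <= s -> 0 <= u /\ (u%:E < eta)%E.
  by move=> u0 us; split=> //; apply: le_lt_trans s_eta; rewrite lee_fin.
have := @convex_functionP R R^o _ _ s' s t conc (D _ s'0 s's) (D _ (ltW s0) (lexx s))
  (ltW t0) (ltW t1).
rewrite /GRing.scale /= (_ : t * s' + (1 - t) * s = s + t * (s' - s)); last by ring.
lra.
Qed.

Lemma desingularizing_homo (eta : \bar R) (phi : R -> R) s s' :
  desingularizing eta phi -> 0 <= s' -> s' <= s -> (s%:E < eta)%E ->
  phi s' <= phi s.
Proof.
move=> dphi s'0 s's s_eta; have [->//|ss'] := eqVneq s' s.
have s0 : 0 < s by apply: le_lt_trans s'0 _; rewrite lt_neqAle ss'.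
have [_ _ _ _ /(_ _ s0 s_eta)[_ _ phi'0]] := dphi.
rewrite -subr_ge0; apply: le_trans (desingularizing_slope dphi s'0 s's s0 s_eta).
by rewrite mulr_ge0 ?(ltW phi'0) // subr_ge0.
Qed.

(* The sets of indices along which the increments obey a KL-type recursion form
   an ideal: potentials may be added. *)
Definition kl_good delta S := exists (K : nat) psi,
  [/\ forall k, (K <= k)%N -> 0 <= psi k,
      forall k, (K <= k)%N -> psi k.+1 <= psi k
    & forall k, (K <= k)%N -> S k ->
        delta k.+1 ^+ 2 <= (psi k - psi k.+1) * delta k].

(** From [K] on, [\sum_(j < k) delta j + psi k + 2 * delta k] does not increase: by the inequality
    of means, [delta k.+1 <= (psi k - psi k.+1 + delta k) / 2]. *)
Lemma kl_good_bounded delta K psi :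
  (forall k, 0 <= delta k) ->
  (forall k, (K <= k)%N -> 0 <= psi k) ->
  (forall k, (K <= k)%N -> psi k.+1 <= psi k) ->
  (forall k, (K <= k)%N -> delta k.+1 ^+ 2 <= (psi k - psi k.+1) * delta k) ->
  forall t, \sum_(k < t) delta k <= \sum_(k < K) delta k + psi K + 2 * delta K.
Proof.
move=> delta0 psi0 psiS rec.
have inv k : \sum_(j < K + k) delta j + psi (K + k)%N + 2 * delta (K + k)%N
    <= \sum_(j < K) delta j + psi K + 2 * delta K.
  elim: k => [|k]; first by rewrite addn0.
  apply: le_trans; rewrite addnS big_ord_recr /=.
  have Kk := leq_addr k K; have := rec _ Kk; have := psiS _ Kk; have := delta0 (K + k)%N.
  move: (\sum_(j < _) _) (psi _) (psi _) (delta (K + k)%N) => s a b e e0 ba h.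
  have : delta (K + k).+1 <= (a - b + e) / 2; last by lra.
  rewrite -ler_sqr ?nnegrE //; last by lra.
  apply: le_trans h _; have := sqr_ge0 (a - b - e); nra.
move=> t; have [tK|Kt] := leqP t K.
  rewrite -addrA -[leLHS]addr0 lerD ?addr_ge0 ?mulr_ge0 ?psi0 //.
  rewrite -(subnKC tK) big_split_ord /= lerDl; exact: sumr_ge0.
apply: le_trans (inv (t - K)%N); rewrite subnKC; last exact: ltnW.
by rewrite -addrA lerDl addr_ge0 ?mulr_ge0 ?psi0 // ltnW.
Qed.

Lemma kl_goodS delta S S' : S `<=` S' -> kl_good delta S' -> kl_good delta S.
Proof.
move=> SS' [K [psi [psi0 psiS rec]]]; exists K, psi; split=> // k Kk Sk.
by apply: rec => //; exact: SS'.
Qed.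

(** On either set, the drop of the other potential is nonnegative and only weakens the recursion. *)
Lemma kl_goodU delta S S' : (forall k, 0 <= delta k) ->
  kl_good delta S -> kl_good delta S' -> kl_good delta (S `|` S').
Proof.
move=> delta0 [K [psi [psi0 psiS rec]]] [K' [psi' [psi'0 psi'S rec']]].
exists (maxn K K'), (fun k => psi k + psi' k); split=> k; rewrite geq_max => /andP[Kk K'k].
- by rewrite addr_ge0 ?psi0 ?psi'0.
- by rewrite lerD ?psiS ?psi'S.
have := psiS _ Kk; have := psi'S _ K'k => h' h.
rewrite opprD addrACA mulrDl => -[Sk|S'k].
  by apply: le_trans (rec _ Kk Sk) _; rewrite lerDl mulr_ge0 // subr_ge0.
by apply: le_trans (rec' _ K'k S'k) _; rewrite lerDr mulr_ge0 // subr_ge0.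
Qed.

(** Were the full set not good, the sets with good complement would form a proper filter; an
    ultrafilter refining it would contain both a good set and its complement. *)
Lemma kl_good_ultra delta : (forall k, 0 <= delta k) ->
  (forall F : set_system nat, UltraFilter F -> \oo `<=` F ->
     exists2 S, F S & kl_good delta S) ->
  kl_good delta setT.
Proof.
move=> delta0 H; apply: contrapT => notgood.
pose G : set_system nat := [set S | kl_good delta (~` S)].
(* The recursion is only required from [K] on, so it is vacuous on an initial segment; hence the
   filter below contains [\oo]. *)
have fin_good N : kl_good delta [set k | (k < N)%N].
  exists N, (fun=> 0); split=> // k Nk /=; by rewrite ltnNge Nk.
have FG : ProperFilter G.
  apply: Build_ProperFilter; first by rewrite /G /= setC0.
  split; first by rewrite /G /= setCT; apply: kl_goodS (fin_good 0%N).
    by move=> A B GA GB; rewrite /G /= setCI; exact: kl_goodU.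
  by move=> A B AB; apply: kl_goodS; exact: subsetC.
have [F [uF GF]] := ultraFilterLemma FG.
have [|S FS goodS] := H F uF.
  move=> A [N _ NA]; apply: GF; apply: kl_goodS (fin_good N) => k /= Ak.
  by rewrite ltnNge; apply/negP => Nk; exact: Ak (NA _ Nk).
have : F (~` S) by apply: GF; rewrite /G /= setCK.
by move=> /(filterI FS); rewrite setICr; exact: filter_not_empty.
Qed.

End kl_sums.

(** * Limits of bounded sequences along an ultrafilter *)

Section ultra_limits.
Context {R : realType} {T : Type} {F : set_system T}.
Implicit Type d : nat.

Lemma ultra_cvg_bounded (u : T -> R) (M : R) : UltraFilter F ->
  (forall k, `|u k| <= M) -> exists l : R, u @ F --> l.
Proof.
move=> uF uM; have pF := @ultra_proper _ _ uF.
have [|l [_ cl]] := @segment_compact R (- M) M (u @ F) _.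
  by apply: (@filterE _ F) => k; rewrite /= in_itv /= -ler_norml; exact: uM.
(* The cluster point is a limit: otherwise the complement of the preimage of [U] belongs to [F], yet
   its image misses [U]. *)
exists l => U lU; have [//|FU] := in_ultra_setVsetC (u @^-1` U) uF.
by have [y [/= nUy Uy]] := cl (~` U) U FU lU.
Qed.

Lemma cvg_colP d (u : T -> 'cV[R]_d) (l : 'cV[R]_d) : Filter F ->
  (forall j, (fun k => u k j 0) @ F --> l j 0) <-> u @ F --> l.
Proof.
move=> fF; split=> [ul U [P lP PU]|ul j]; last first.
  apply: (@cvg_comp _ _ _ u (fun M : 'cV[R]_d => M j 0) F (nbhs l) (nbhs (l j 0)) ul).
  exact: coord_continuous.
have : \forall k \near F, forall j, P j 0 (u k j 0).
  by apply: filter_forall => j; exact: ul (lP j 0).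
by apply: filterS => k Pk; apply: PU => i j /=; rewrite ord1.
Qed.

Lemma ultra_cvg_col d (u : T -> 'cV[R]_d) M : UltraFilter F ->
  (forall k, enorm (u k) <= M) -> exists l : 'cV[R]_d, u @ F --> l.
Proof.
move=> uF uM.
have /choice[l ul] (j : 'I_d) : exists l : R, (fun k => u k j 0) @ F --> l.
  by apply: ultra_cvg_bounded => k; apply: le_trans (enorm_coord _ _) (uM k).
exists (\col_j l j); apply/cvg_colP => j; rewrite mxE; exact: ul.
Qed.

Context {FF : Filter F}.

Lemma cvg_sumr (V : normedModType R) (I : Type) (r : seq I) (P : pred I)
    (u : I -> T -> V) (l : I -> V) :
  (forall i, P i -> u i @ F --> l i) ->
  (fun k => \sum_(i <- r | P i) u i k) @ F --> \sum_(i <- r | P i) l i.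
Proof. by apply: cvg_big => //; exact: add_continuous. Qed.

Lemma cvg_dot d (u v : T -> 'cV[R]_d) (l m : 'cV[R]_d) : u @ F --> l -> v @ F --> m ->
  (fun k => dot (u k) (v k)) @ F --> dot l m.
Proof.
move=> /cvg_colP ul /cvg_colP vm; apply: cvg_sumr => j _; exact: cvgM.
Qed.

Lemma cvg_enorm d (u : T -> 'cV[R]_d) (l : 'cV[R]_d) : u @ F --> l ->
  (fun k => enorm (u k)) @ F --> enorm l.
Proof.
by move=> ul; apply: (cvg_comp _ _ (cvg_dot ul ul)); exact: sqrt_continuous.
Qed.

Lemma cvg_mulmx d e (A : 'M[R]_(e, d)) (u : T -> 'cV[R]_d) (l : 'cV[R]_d) : u @ F --> l ->
  (fun k => A *m u k) @ F --> A *m l.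
Proof.
move=> /cvg_colP ul; apply/cvg_colP => i; rewrite !mxE.
under eq_fun do rewrite mxE.
by apply: cvg_sumr => j _; apply: cvgMr; exact: ul.
Qed.

End ultra_limits.

(** * One step of the method *)

Section block_sums.
Context {R : realType} {N d : nat}.
Implicit Types v : 'I_N -> 'cV[R]_d.

(** While block [i] is updated, the blocks [j > i] are still old. For [v] the increments, this is
    the gap between the residual that block [i] sees at its new value and the residual at the end of
    the sweep. *)
Definition tail_sum v (i : 'I_N) : 'cV[R]_d := \sum_(j : 'I_N | (i < j)%N) v j.

Lemma dot_sum_tail v : dot (\sum_i v i) (\sum_i v i) =
  \sum_i dot (v i) (v i) + 2 * \sum_i dot (tail_sum v i) (v i).
Proof.
rewrite dot_sumr [X in _ = _ + X](_ : _ = \sum_i dot (tail_sum v i) (v i) +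
    \sum_(i < N) \sum_(j < N | (j < i)%N) dot (v j) (v i)); last first.
  rewrite mulr_natl mulr2n; congr (_ + _).
  rewrite [RHS](exchange_big_dep xpredT) //=; apply: eq_bigr => j _.

  by rewrite dot_suml; apply: eq_bigr => i _; rewrite dotC.
rewrite -!big_split /=; apply: eq_bigr => i _.
rewrite !dot_suml (bigD1 i) //= (bigID (fun j : 'I_N => (i < j)%N)) /=.
congr (_ + (_ + _)); apply: eq_bigl => j; rewrite -val_eqE /=.
  by case: ltngtP.
by case: ltngtP.
Qed.

Definition block_norm v : R := Num.sqrt (\sum_i enorm (v i) ^+ 2).

Lemma block_norm_ge0 v : 0 <= block_norm v.
Proof. exact: sqrtr_ge0. Qed.

Lemma block_norm_sqr v : block_norm v ^+ 2 = \sum_i enorm (v i) ^+ 2.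
Proof. by rewrite sqr_sqrtr // sumr_ge0 // => i _; rewrite sqr_ge0. Qed.

Lemma enorm_le_block v i : enorm (v i) <= block_norm v.
Proof.
rewrite -ler_sqr ?nnegrE ?enorm_ge0 ?block_norm_ge0 // block_norm_sqr (bigD1 i) //=.
by rewrite lerDl sumr_ge0 // => j _; rewrite sqr_ge0.
Qed.

Lemma enorm_tail_sum v i : enorm (tail_sum v i) <= N%:R * block_norm v.
Proof.
apply: le_trans (ler_enorm_sum _ _ _) _.
rewrite mulr_natl -[X in _ *+ X]card_ord -sumr_const big_mkcond /=.
by apply: ler_sum => j _; case: ifP; rewrite ?enorm_le_block ?block_norm_ge0.
Qed.

Lemma uniform_bound (u : nat -> 'I_N -> R) :
  (forall i, exists M, forall k, u k i <= M) ->
  exists2 M, 0 <= M & forall k i, u k i <= M.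
Proof.
move=> /choice[M uM]; exists (\sum_i `|M i|) => [|k i]; first exact: sumr_ge0.
apply: le_trans (uM i k) _; apply: le_trans (ler_norm _) _.
by rewrite (bigD1 i) //= lerDl sumr_ge0.
Qed.

Lemma ler_wnorm (n : 'I_N -> nat) (w : @wspace R N n d) :
  wnorm w <= \sum_i enorm (w.1 i) + enorm w.2.
Proof.
have s0 : 0 <= \sum_i enorm (w.1 i) by apply: sumr_ge0 => i _; exact: enorm_ge0.
have w20 := enorm_ge0 w.2.
rewrite -[leRHS]ger0_norm ?addr_ge0 // -sqrtr_sqr ler_wsqrtr //.
suff : \sum_i enorm (w.1 i) ^+ 2 <= (\sum_i enorm (w.1 i)) ^+ 2.
  by rewrite sqrrD; have := mulr_ge0 s0 w20; lra.
suff [] : 0 <= \sum_i enorm (w.1 i) /\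
    \sum_i enorm (w.1 i) ^+ 2 <= (\sum_i enorm (w.1 i)) ^+ 2 by [].
elim/big_ind2 : _ => [|a c a' c' [a0 ca] [a'0 ca']|i _].
- by rewrite expr0n.
- by split; [rewrite addr_ge0|rewrite sqrrD; have := mulr_ge0 a0 a'0; lra].
- by split; first exact: enorm_ge0.
Qed.

End block_sums.

(** Old minus new, measured after applying [A i]: the descent estimate controls these images, not
    the steps of [x k i] themselves. *)
Definition increment {R : realType} {N p : nat} {n : 'I_N -> nat}
    (A : forall i, 'M[R]_(p, n i)) (x : nat -> forall i, 'cV[R]_(n i))
    (k : nat) (i : 'I_N) : 'cV[R]_p :=
  A i *m x k i - A i *m x k.+1 i.

(** * Optimality of the block updates and the dual step *)

Section admm_steps.
Context {R : realType} {N p : nat} {n : 'I_N -> nat}.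
Context {A : forall i, 'M[R]_(p, n i)} {b : 'cV[R]_p}.
Context {X : forall i, set 'cV[R]_(n i)} {f : forall i, 'cV[R]_(n i) -> R}.
Context {gamma : R} {x : nat -> forall i, 'cV[R]_(n i)} {lam : nat -> 'cV[R]_p}.
Arguments X : clear implicits.
Arguments f : clear implicits.
Context (X_convex : forall i, convex_set (X i)).
Context (f_convex : forall i, convex_function setT (f i)).
Context (gamma_gt0 : 0 < gamma) (admm : multiblock_ADMM A b X f gamma x lam).

Lemma residual_increment k :
  residual A b (x k) = residual A b (x k.+1) + \sum_i increment A x k i.
Proof. by rewrite sumrB /residual [RHS]addrC addrA subrK. Qed.

Lemma admm_dual k : lam k = lam k.+1 + gamma *: residual A b (x k.+1).
Proof. by rewrite (admm k).2 subrK. Qed.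

Lemma admm_feasible k i : X i (x k.+1 i).
Proof. by have [/(_ i)[]] := admm k. Qed.

(** This is the first-order condition of the subproblem. The residual it sees is the final one plus
    the tail sum, and the dual update absorbs the first part into [lam k.+1]. *)
Lemma admm_ineq k i y : X i y ->
  f i (x k.+1 i) + dot (lam k.+1 - gamma *: tail_sum (increment A x k) i)
                       (A i *m (y - x k.+1 i)) <= f i y.
Proof.
move=> Xy; have [/(_ i)[Xx xmin] lamS] := admm k.
pose z (j : 'I_N) := if (j < i)%N then x k.+1 j else x k j.
pose c := \sum_(j | j != i) A j *m z j - b.
have res_z xi : residual A b (dfwith z i xi) = A i *m xi + c.
  rewrite /residual (bigD1 i) //= dfwithin addrA; congr (_ + _ - _).
  by apply: eq_bigr => j ji; rewrite dfwithout // eq_sym.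
have obj_z xi : objective f (dfwith z i xi) = f i xi + \sum_(j | j != i) f j (z j).
  rewrite /objective (bigD1 i) //= dfwithin; congr (_ + _).
  by apply: eq_bigr => j ji; rewrite dfwithout // eq_sym.
have xarg : argmin (X i) (fun y => f i y - dot (lam k) (A i *m y + c)
    + gamma / 2 * enorm (A i *m y + c) ^+ 2) (x k.+1 i).
  by split=> // xi /xmin; rewrite /auglag !res_z !obj_z; lra.
have := argmin_quadratic_ineq (ltW gamma_gt0) (@X_convex i) (@f_convex i) xarg Xy.
suff -> : A i *m x k.+1 i + c = residual A b (x k.+1) + tail_sum (increment A x k) i.
  rewrite {1}(admm_dual k); move: (residual _ _ _) => r.
  by rewrite scalerDr opprD addrA addrK.
rewrite /residual (bigD1 i) //= /c !addrA [RHS]addrAC; congr (_ + _).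
rewrite -[RHS]addrA; congr (_ + _); rewrite /tail_sum (bigID (fun j : 'I_N => (i < j)%N)) /=.
rewrite [in RHS](bigID (fun j : 'I_N => (i < j)%N)) /= [RHS]addrAC; congr (_ + _).
  rewrite [X in _ = _ + X](_ : _ = \sum_(j < N | (j != i) && (i < j)%N) increment A x k j).
    rewrite -big_split /=; apply: eq_bigr => j /andP[_ ij].
    by rewrite /z ltnNge (ltnW ij) /= addrC subrK.
  by apply: eq_bigl => j; case: (eqVneq j i) => [->|//]; rewrite ltnn.
apply: eq_bigr => j /andP[ji]; rewrite -leqNgt => ij.
by rewrite /z ltn_neqAle ij andbT val_eqE ji.
Qed.

(** The block inequalities are tested at the old iterate and summed; their cross terms cancel those
    of the expanded square of the summed increments. The dual step costs [gamma] times the squared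
    residual. *)
Lemma admm_decrease k : (forall i, X i (x k i)) ->
  gamma / 2 * block_norm (increment A x k) ^+ 2
    - gamma * enorm (residual A b (x k.+1)) ^+ 2 <=
  auglag A b f gamma (x k) (lam k) - auglag A b f gamma (x k.+1) (lam k.+1).
Proof.
move=> Xx; rewrite block_norm_sqr /auglag (residual_increment k) (admm_dual k).
have : \sum_i (f i (x k.+1 i) + dot (lam k.+1 - gamma *: tail_sum (increment A x k) i)
    (increment A x k i)) <= objective f (x k).
  by apply: ler_sum => i _; rewrite /increment -mulmxBr; exact: admm_ineq.
rewrite big_split /= -/(objective f (x k.+1)).
have -> : \sum_i dot (lam k.+1 - gamma *: tail_sum (increment A x k) i) (increment A x k i)
    = dot (lam k.+1) (\sum_i increment A x k i)
      - gamma * \sum_i dot (tail_sum (increment A x k) i) (increment A x k i).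
  rewrite dot_sumr mulr_sumr -sumrB; apply: eq_bigr => i _.
  by rewrite dotDl dotNl dotZl.
have -> : \sum_i enorm (increment A x k i) ^+ 2 =
    \sum_i dot (increment A x k i) (increment A x k i).
  by apply: eq_bigr => i _; rewrite enorm_sqr.
have := dot_sum_tail (increment A x k).
move: (\sum_i increment A x k i) (\sum_i dot _ (increment A x k i)) (\sum_i dot _ _)
  (residual _ _ _) => D s t r.
rewrite !enorm_sqr !dotE => ->.
by rewrite (dotC D r); lra.
Qed.

(* [2 (l - l') . (lam - l) = |l' - lam|^2 - |l' - l|^2 - |l - lam|^2] turns the dual
   update into a telescoping term. *)
Lemma admm_gap k (us : forall i, 'cV[R]_(n i)) l :
  (forall i, X i (us i)) -> \sum_i A i *m us i = b ->
  objective f (x k.+1) - objective f us - dot l (residual A b (x k.+1)) <=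
  (enorm (l - lam k) ^+ 2 - enorm (l - lam k.+1) ^+ 2) / (2 * gamma)
  + gamma * \sum_i dot (tail_sum (increment A x k) i) (A i *m (us i - x k.+1 i)).
Proof.
move=> Xus Aus.
have : \sum_i (f i (x k.+1 i) + dot (lam k.+1 - gamma *: tail_sum (increment A x k) i)
    (A i *m (us i - x k.+1 i))) <= objective f us.
  by apply: ler_sum => i _; exact: admm_ineq.
rewrite big_split /= -/(objective f (x k.+1)).
have -> : \sum_i dot (lam k.+1 - gamma *: tail_sum (increment A x k) i)
      (A i *m (us i - x k.+1 i)) = - dot (lam k.+1) (residual A b (x k.+1))
    - gamma * \sum_i dot (tail_sum (increment A x k) i) (A i *m (us i - x k.+1 i)).
  rewrite -dotNr /residual -Aus opprB -sumrB dot_sumr mulr_sumr -sumrB.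
  by apply: eq_bigr => i _; rewrite dotDl dotNl dotZl mulmxBr.
rewrite (admm_dual k).
move: (\sum_i dot _ _) (residual _ _ _) => s r h; rewrite !enorm_sqr !dotE.
have g2 : 0 < 2 * gamma by rewrite mulr_gt0.
rewrite -lerBlDr ler_pdivlMr //.
have := mulr_ge0 (sqr_ge0 gamma) (dotxx_ge0 r).
rewrite (dotC (lam k.+1) l) (dotC r l) (dotC r (lam k.+1)).
have := ler_wpM2r (ltW g2) h; lra.
Qed.

End admm_steps.

(** * Descent and summability of the increments *)

Section admm_descent.
Context {R : realType} {N p : nat} {n : 'I_N -> nat}.
Context {A : forall i, 'M[R]_(p, n i)} {b : 'cV[R]_p}.
Context {X : forall i, set 'cV[R]_(n i)} {f : forall i, 'cV[R]_(n i) -> R}.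
Context {iN : 'I_N} {L gamma : R} {fs : 'I_N -> R}.
Context {x : nat -> forall i, 'cV[R]_(n i)} {lam : nat -> 'cV[R]_p}.
Arguments X : clear implicits.
Arguments f : clear implicits.
Context (X_convex : forall i, convex_set (X i)).
Context (f_convex : forall i, convex_function setT (f i)).
Context (X_closed : forall i, closed (X i)).
Context (f_closed : forall i, closed_function (f i)).
Context (AAT : A iN *m (A iN)^T = 1%:M) (ATA : (A iN)^T *m A iN = 1%:M).
Context (XN_full : X iN = setT) (L_ge0 : 0 <= L).
Context (fN_diff : forall y, differentiable (f iN) y).
Context (fN_lip : forall y z,
  enorm (grad (f iN) y - grad (f iN) z) <= L * enorm (y - z)).
Context (gamma_gt0 : 0 < gamma) (gamma_gt : Num.sqrt 2 * L < gamma).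
Context (f_lb : forall i y, X i y -> fs i <= f i y).
Context (f_coercive : forall i, i != iN -> coercive (extend (X i) (f i))).
Context (KL_auglag :
  KL_function (auglag_ext A b X f gamma) (subdiff_auglag A b X f gamma)).
Context (admm : multiblock_ADMM A b X f gamma x lam).
Context (x_feas : forall k i, X i (x k i)).
Context (lam_grad : forall k, (A iN)^T *m lam k = grad (f iN) (x k iN)).

Let H k := auglag A b f gamma (x k) (lam k).
Let r k := residual A b (x k).
Let delta k := block_norm (increment A x k).

Lemma gamma_sqr_gt : 2 * L ^+ 2 < gamma ^+ 2.
Proof.
have s0 : 0 <= Num.sqrt 2 * L by rewrite mulr_ge0 ?sqrtr_ge0.
have := gamma_gt; rewrite -ltr_sqr ?nnegrE ?(ltW gamma_gt0) //.
by rewrite exprMn sqr_sqrtr ?ler0n.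
Qed.

(** Positivity amounts to [2 * L ^+ 2 < gamma ^+ 2], the source of the threshold
    [Num.sqrt 2 * L]. *)
Lemma descent_rate_gt0 : 0 < gamma / 2 - L ^+ 2 / gamma.
Proof.
rewrite subr_gt0 ltr_pdivrMr // mulrAC ltr_pdivlMr //; have := gamma_sqr_gt; lra.
Qed.

Lemma residual_rate_gt0 : 0 < gamma / 2 - 2 / 3 * L.
Proof.
(* The factor 4/3 is below the square root of 2, since 16/9 < 2. *)
suff : 4 / 3 * L < gamma by lra.
rewrite -ltr_sqr ?nnegrE ?(ltW gamma_gt0) ?mulr_ge0 //.
by have := gamma_sqr_gt; have := sqr_ge0 L; nra.
Qed.

Lemma dual_lipschitz k l : enorm (lam k - lam l) <= L * enorm (x k iN - x l iN).
Proof.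
rewrite -(@enorm_mulmx_isometry _ _ _ (A iN)^T); last by rewrite trmxK.
by rewrite mulmxBr !lam_grad.
Qed.

(** The scaled residual is a difference of multipliers, hence of gradients of the last block, and
    [A iN] preserves norms. *)
Lemma residual_le_increment k : gamma * enorm (r k.+1) <= L * delta k.
Proof.
rewrite -(ger0_norm (ltW gamma_gt0)) -enormZ.
have -> : gamma *: r k.+1 = lam k - lam k.+1 by rewrite (admm_dual admm k) addrAC subrr add0r.
apply: le_trans (dual_lipschitz _ _) _; rewrite ler_wpM2l //.
rewrite -(@enorm_mulmx_isometry _ _ _ (A iN)) // mulmxBr.
exact: (enorm_le_block (increment A x k)).
Qed.

Lemma auglag_decrease k :
  (gamma / 2 - L ^+ 2 / gamma) * delta k ^+ 2 <= H k - H k.+1.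
Proof.
apply: le_trans (admm_decrease X_convex f_convex gamma_gt0 admm (x_feas k)).
rewrite mulrBl lerD2l lerN2 -/(r k.+1) mulrAC ler_pdivlMr //.
have := residual_le_increment k; rewrite -ler_sqr ?nnegrE; last 2 first.
- by rewrite mulr_ge0 ?enorm_ge0 ?(ltW gamma_gt0).
- by rewrite mulr_ge0 ?block_norm_ge0.
by rewrite !exprMn; lra.
Qed.

Lemma auglag_nonincreasing k l : (k <= l)%N -> H l <= H k.
Proof.
move/subnK <-; elim: (l - k)%N => [//|m]; apply: le_trans.
rewrite -subr_ge0; apply: le_trans (auglag_decrease _).
by rewrite mulr_ge0 ?sqr_ge0 // ltW ?descent_rate_gt0.
Qed.

(* [lam k] is the gradient of the last block, so the descent inequality at
   [x_N - A_N^T r] absorbs the linear term of the Lagrangian. *)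
Lemma auglag_lower k :
  \sum_(i | i != iN) f i (x k i) + fs iN
    + (gamma / 2 - 2 / 3 * L) * enorm (r k) ^+ 2 <= H k.
Proof.
rewrite /H /auglag /objective [\sum_i f i _](bigD1 iN) //= -/(r k).
have := convex_descent (x k iN) (x k iN - (A iN)^T *m r k) (@f_convex iN) fN_diff fN_lip.
have := @f_lb iN (x k iN - (A iN)^T *m r k); rewrite XN_full => /(_ I).
have -> : x k iN - (A iN)^T *m r k - x k iN = - ((A iN)^T *m r k).
  by rewrite addrAC subrr add0r.
rewrite -lam_grad dotNr dot_mulmx mulmxA trmxK AAT mul1mx.
rewrite enormN (@enorm_mulmx_isometry _ _ _ (A iN)^T) ?trmxK //.
lra.
Qed.

Lemma residual_bounded : exists M, forall k, enorm (r k) <= M.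
Proof.
set c := gamma / 2 - 2 / 3 * L; have c0 : 0 < c := residual_rate_gt0.
(* The bound [a <= 1 + a ^+ 2] avoids a square root. *)
exists (1 + (H 0%N - \sum_i fs i) / c) => k.
have : c * enorm (r k) ^+ 2 <= H 0%N - \sum_i fs i.
  have := auglag_lower k; have := auglag_nonincreasing (leq0n k).
  have : \sum_(i | i != iN) fs i <= \sum_(i | i != iN) f i (x k i).
    by apply: ler_sum => i _; exact: f_lb.
  by rewrite [\sum_i fs i](bigD1 iN) //= -/c; lra.
rewrite mulrC -ler_pdivlMr // => h; apply: le_trans (lerD (lexx 1) h).
by have := sqr_ge0 (enorm (r k) - 1); have := sqr_ge0 (enorm (r k)); nra.
Qed.

Lemma objective_block_upper k i : i != iN -> f i (x k i) <= H 0%N - \sum_(j | j != i) fs j.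
Proof.
move=> iN'; have := auglag_lower k; have := auglag_nonincreasing (leq0n k).
have := mulr_ge0 (ltW residual_rate_gt0) (sqr_ge0 (enorm (r k))).
rewrite (bigD1 i) //= [\sum_(j | j != i) fs j](bigD1 iN) 1?eq_sym //=.
have : \sum_(j | (j != i) && (j != iN)) fs j <= \sum_(j | (j != iN) && (j != i)) f j (x k j).
  rewrite (eq_bigl (fun j => (j != iN) && (j != i))); last by move=> j; rewrite andbC.
  by apply: ler_sum => j _; exact: f_lb.
lra.
Qed.

(** Coercivity bounds all blocks but the last, which is then recovered from the residual through the
    isometry [A iN]. *)
Lemma primal_bounded : exists2 M, 0 <= M & forall k i, enorm (x k i) <= M.
Proof.
have others i : i != iN -> exists M, forall k, enorm (x k i) <= M.
  move=> iN'; pose M := H 0%N - \sum_(j | j != i) fs j.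
  have [rho coer] := f_coercive iN' (M + 1).
  exists rho => k; apply/ltW; rewrite ltNge; apply/negP => /coer.
  rewrite /extend /indicator mem_set // adde0 lee_fin.
  by have := objective_block_upper k iN'; rewrite -/M; lra.
apply: uniform_bound => i; have [->{i}|] := eqVneq i iN; last exact: others.
have /choice[M oM] (j : 'I_N) : exists M, j != iN -> forall k, enorm (A j *m x k j) <= M.
  have [//|jN] := eqVneq j iN; first by exists 0.
  have [[M xM] [C C0 AC]] := (others j jN, mulmx_bounded (A j)).
  by exists (C * M) => _ k; apply: le_trans (AC _) _; rewrite ler_wpM2l.
have [M' rM'] := residual_bounded.
exists (M' + enorm b + \sum_(j | j != iN) M j) => k.
rewrite -(@enorm_mulmx_isometry _ _ _ (A iN)) //.
have -> : A iN *m x k iN = r k + b - \sum_(j | j != iN) A j *m x k j.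
  by rewrite /r /residual subrK (bigD1 iN) //= addrK.
apply: le_trans (ler_enormB _ _) _; apply: lerD.
  by apply: le_trans (ler_enormD _ _) _; rewrite lerD2r.
by apply: le_trans (ler_enorm_sum _ _ _) _; apply: ler_sum => j jN; exact: oM.
Qed.

Lemma dual_bounded : exists2 M, 0 <= M & forall k, enorm (lam k) <= M.
Proof.
have [M M0 xM] := primal_bounded.
exists (L * (M + M) + enorm (lam 0%N)) => [|k].
  by rewrite addr_ge0 ?enorm_ge0 // mulr_ge0 // addr_ge0.
rewrite -[lam k](subrK (lam 0%N)); apply: le_trans (ler_enormD _ _) _.
rewrite lerD2r; apply: le_trans (dual_lipschitz _ _) _; rewrite ler_wpM2l //.
by apply: le_trans (ler_enormB _ _) _; rewrite lerD.
Qed.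

Lemma objective_bounded i : exists M, forall k, `|f i (x k i)| <= M.
Proof.
have up : exists M, forall k, f i (x k i) <= M.
  have [->{i}|iN'] := eqVneq i iN; last by eexists => k; exact: objective_block_upper.
  (* For the last block the upper bound is read off the Lagrangian, whose linear term is controlled
     by the bounds on multipliers and residuals. *)
  have [[M M0 lamM] [M' rM']] := (dual_bounded, residual_bounded).
  exists (H 0%N - \sum_(j | j != iN) fs j + M * M') => k.
  have := auglag_nonincreasing (leq0n k); rewrite {1}/H /auglag /objective (bigD1 iN) //=.
  have : \sum_(j | j != iN) fs j <= \sum_(j | j != iN) f j (x k j).
    by apply: ler_sum => j _; exact: f_lb.
  have := cauchy_schwarz (lam k) (r k).
  have := ler_pM (enorm_ge0 _) (enorm_ge0 _) (lamM k) (rM' k).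
  have := mulr_ge0 (ltW gamma_gt0) (sqr_ge0 (enorm (r k))).
  rewrite -/(r k); lra.
have [M fM] := up; exists (`|M| + `|fs i|) => k; rewrite ler_norml.
have := f_lb (x_feas k i); have := fM k.
by have := ler_norm M; have := ler_norm (fs i); have := ler_norm (- fs i);
  have := ler_norm (- M); rewrite !normrN; lra.
Qed.

Let Hinf := inf (range H).

Lemma auglag_has_lbound : has_lbound (range H).
Proof.
exists (\sum_i fs i) => _ [k _ <-]; apply: le_trans (auglag_lower k).
have := mulr_ge0 (ltW residual_rate_gt0) (sqr_ge0 (enorm (r k))).
have : \sum_(i | i != iN) fs i <= \sum_(i | i != iN) f i (x k i).
  by apply: ler_sum => i _; exact: f_lb.
by rewrite [\sum_i fs i](bigD1 iN) //=; lra.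
Qed.

Lemma auglag_cvg : H @ \oo --> Hinf.
Proof.
by apply: nonincreasing_cvgn auglag_has_lbound => k l; exact: auglag_nonincreasing.
Qed.

Lemma auglag_ge_inf k : Hinf <= H k.
Proof. by apply: (ge_inf auglag_has_lbound); exists k. Qed.

Lemma block_increment_cvg0 : delta @ \oo --> 0.
Proof.
have sqr0 : (fun k => delta k ^+ 2) @ \oo --> 0.
  have c0 := descent_rate_gt0; set c := (_ - _) in c0.
  apply: (@squeeze_cvgr _ _ _ _ (fun=> 0) (fun k => c^-1 * (H k - H k.+1))).
  - apply: nearW => k; rewrite sqr_ge0 /= mulrC ler_pdivlMr // mulrC.
    exact: auglag_decrease.
  - exact: cvg_cst.
  - rewrite -(mulr0 c^-1) -(subrr Hinf); apply: cvgMr; apply: cvgB; first exact: auglag_cvg.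
    by have := auglag_cvg; rewrite -cvg_shiftS.
rewrite (_ : delta = Num.sqrt \o (fun k => delta k ^+ 2)).
  by rewrite -sqrtr0; apply: (cvg_comp _ _ sqr0); exact: sqrt_continuous.
by apply/funext => k /=; rewrite sqrtr_sqr ger0_norm // block_norm_ge0.
Qed.

Lemma increment_cvg0 i : (fun k => increment A x k i) @ \oo --> (0 : 'cV[R]_p).
Proof.
apply/cvg_colP => j; rewrite mxE; apply: norm_cvg0.
apply: (@squeeze_cvgr _ _ _ _ (fun=> 0) delta).
- apply: nearW => k; rewrite normr_ge0 /=; apply: le_trans (enorm_coord _ _) _.
  exact: (enorm_le_block (increment A x k)).
- exact: cvg_cst.
- exact: block_increment_cvg0.
Qed.

(* Boundedness of [f i (x k i)] makes these values converge along the ultrafilter,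
   to some [v]; closedness of the epigraph gives [f xl <= v], and the variational
   inequality at [y := xl] the converse. *)
Lemma admm_ultra_limit (F : set_system nat) : UltraFilter F -> \oo `<=` F ->
  exists (xl : forall i, 'cV[R]_(n i)) (ll : 'cV[R]_p),
  [/\ forall i, (fun k => x k.+1 i) @ F --> xl i,
      (fun k => lam k.+1) @ F --> ll,
      forall i, X i (xl i),
      forall i y, X i y -> f i (xl i) + dot ll (A i *m (y - xl i)) <= f i y
    & auglag A b f gamma xl ll = Hinf].
Proof.
move=> uF ooF; have pF := @ultra_proper _ _ uF.
have [[M _ xM] [M' _ lamM]] := (primal_bounded, dual_bounded).
have xcv i : exists l : 'cV[R]_(n i), (fun k => x k.+1 i) @ F --> l.
  exact: (ultra_cvg_col uF (fun k => xM k.+1 i)).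
pose xl i := projT1 (cid (xcv i)).
have xlP i : (fun k => x k.+1 i) @ F --> xl i := projT2 (cid (xcv i)).
have [ll llP] := ultra_cvg_col uF (fun k => lamM k.+1).
have /choice[v vP] i : exists v : R, (fun k => f i (x k.+1 i)) @ F --> v.
  have [Mf fM] := objective_bounded i.
  exact: (ultra_cvg_bounded uF (fun k => fM k.+1)).
have Xxl i : X i (xl i).
  apply: (closed_cvg (X i) (@X_closed i) _ (xl i) (xlP i)).
  by apply: nearW => k; exact: x_feas.
have vi i y : X i y -> v i + dot ll (A i *m (y - xl i)) <= f i y.
  move=> Xy; apply: (@ler_cvg_to nat F pF R (fun k => f i (x k.+1 i) +
    dot (lam k.+1 - gamma *: tail_sum (increment A x k) i) (A i *m (y - x k.+1 i)))
    (fun=> f i y)).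
  - apply: cvgD; first exact: vP.
    apply: cvg_dot; last first.
      by apply: cvg_mulmx; apply: cvgB; [exact: cvg_cst|exact: xlP].
    rewrite -[X in _ --> X]subr0 -(scaler0 _ gamma); apply: cvgB; first exact: llP.
    apply: cvgZr; rewrite [X in _ --> X](_ : _ = \sum_(j : 'I_N | (i < j)%N) 0); last first.
      by rewrite big1.
    apply: cvg_sumr => j _; apply: cvg_trans (increment_cvg0 j) => U; exact: ooF.
  - exact: cvg_cst.
  - by apply: nearW => k; exact: (admm_ineq X_convex f_convex gamma_gt0 admm).
have vE i : v i = f i (xl i).
  apply/eqP; rewrite eq_le; apply/andP; split.
    by have := vi i _ (Xxl i); rewrite subrr mulmx0 dot0r addr0.
  apply: (closed_cvg _ (@f_closed i) _ (xl i, v i) (cvg_pair (xlP i) (vP i))).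
  by apply: nearW => k /=.
exists xl, ll; split=> // [i y|]; first by rewrite -vE; exact: vi.
have Hcv : (fun k => H k.+1) @ F --> Hinf.
  have := auglag_cvg; rewrite -cvg_shiftS => oocv.
  by apply: cvg_trans oocv => U; exact: ooF.
apply: (cvg_unique (@norm_hausdorff _ R^o) _ Hcv).
have rescv : (fun k => r k.+1) @ F --> residual A b xl.
  apply: cvgB; last exact: cvg_cst.
  by apply: cvg_sumr => i _; apply: cvg_mulmx; exact: xlP.
apply: cvgD; [apply: cvgB|].
- by apply: cvg_sumr => i _; rewrite -vE; exact: vP.
- exact: cvg_dot.
- by apply: cvgMr; rewrite expr2; under eq_fun do rewrite expr2; apply: cvgM; exact: cvg_enorm.
Qed.

Lemma subdiff_auglag_le_increment : exists2 C, 0 <= C & forall k,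
  exists2 v, subdiff_auglag A b X f gamma (x k.+1, lam k.+1) v & wnorm v <= C * delta k.
Proof.
have /choice[CA CAP] i : exists C, 0 <= C /\ forall y, enorm ((A i)^T *m y) <= C * enorm y.
  by have [C C0 CP] := mulmx_bounded (A i)^T; exists C.
exists ((\sum_i CA i) * (L + gamma * N%:R) + L / gamma) => [|k].
  rewrite addr_ge0 ?divr_ge0 ?(ltW gamma_gt0) // mulr_ge0 ?sumr_ge0 // => [i _|].
    exact: (CAP i).1.
  by rewrite addr_ge0 // mulr_ge0 ?ler0n ?(ltW gamma_gt0).
pose S i := tail_sum (increment A x k) i.
(* The subgradient of block [i] comes from its optimality condition; the [lam k.+1] terms cancel,
   leaving only the residual and the tail sum, both of the size of the increments. *)
exists (fun i => gamma *: ((A i)^T *m (r k.+1 - S i)), - r k.+1).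
  split=> [i /=|/=]; last by rewrite /r /residual opprB.
  exists ((A i)^T *m (lam k.+1 - gamma *: S i)); last first.
    rewrite -/(r _); move: (r _) (lam _) (S i) => u v w.
    by rewrite !mulmxBr -scalemxAr scalerBr [RHS]addrC [X in _ = _ + X]addrAC subrr add0r.
  split=> [|y]; first by rewrite /extend /indicator mem_set.
  rewrite /extend /indicator mem_set // adde0.
  have [/set_mem Xy|_] := boolP (y \in X i); last by rewrite addey // leey.
  rewrite adde0 -EFinD lee_fin dotC -[(A i)^T *m _]trmxK.
  have := admm_ineq X_convex f_convex gamma_gt0 admm k Xy.
  by rewrite dotC dot_mulmx trmxK dotC.
have res_le : enorm (r k.+1) <= L / gamma * delta k.
  by rewrite mulrAC ler_pdivlMr // mulrC residual_le_increment.
apply: le_trans (ler_wnorm _) _ => /=.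
rewrite enormN mulrDl lerD // -mulrA mulr_suml; apply: ler_sum => i _.
rewrite enormZ (ger0_norm (ltW gamma_gt0)).
apply: le_trans (ler_wpM2l (ltW gamma_gt0) ((CAP i).2 _)) _.
rewrite mulrCA ler_wpM2l ?(CAP i).1 //.
apply: le_trans (ler_wpM2l (ltW gamma_gt0) (ler_enormB _ _)) _.
rewrite mulrDr mulrDl lerD ?residual_le_increment //.
by rewrite -mulrA ler_wpM2l ?(ltW gamma_gt0) // enorm_tail_sum.
Qed.

Lemma kl_ultra_good (F : set_system nat) : UltraFilter F -> \oo `<=` F ->
  exists2 S, F S & kl_good delta S.
Proof.
move=> uF ooF; have pF := @ultra_proper _ _ uF.
have [xl [ll [xlP llP Xxl xl_sub aug_inf]]] := admm_ultra_limit uF ooF.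
have [C C0 vC] := subdiff_auglag_le_increment.
have ext w : Omega X w -> auglag_ext A b X f gamma w = (auglag A b f gamma w.1 w.2)%:E.
  by move=> Xw; rewrite /auglag_ext /extend /indicator mem_set // adde0.
(* The KL property requires a nonempty subdifferential: the variational inequality at the limit
   makes [(A i)^T *m ll] a subgradient of block [i]. *)
have [_ _ /(_ (xl, ll))] := KL_auglag; case.
  exists (fun i => (A i)^T *m ll - (A i)^T *m ll + gamma *: ((A i)^T *m residual A b xl),
    b - \sum_i A i *m xl i); split=> // i /=.
  exists ((A i)^T *m ll) => //; split=> [|y]; first by rewrite /extend /indicator mem_set.
  rewrite /extend /indicator mem_set // adde0.
  have [/set_mem Xy|_] := boolP (y \in X i); last by rewrite addey // leey.
  by rewrite adde0 -EFinD lee_fin dot_mulmx trmxK; exact: xl_sub.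
move=> eta [W0 [phi [eta0 [e e0 W0P] dphi]]].
rewrite ext //= aug_inf => KL.
exists [set k | W0 (x k.+1, lam k.+1)].
  have : (fun k => \sum_i enorm (x k.+1 i - xl i) + enorm (lam k.+1 - ll)) @ F --> (0 : R).
    rewrite -[X in _ --> X](_ : \sum_i enorm (xl i - xl i) + enorm (ll - ll) = 0); last first.
      by rewrite subrr enorm0 addr0 big1 // => i _; rewrite subrr enorm0.
    apply: cvgD; [apply: cvg_sumr => i _|]; apply: cvg_enorm; apply: cvgB;
      [exact: xlP|exact: cvg_cst|exact: llP|exact: cvg_cst].
  move/cvgr_lt => /(_ _ e0); apply: filterS => k /= ke; apply: W0P.
  by apply: (le_lt_trans (ler_wnorm (wsub _ _))); exact: ke.
pose s k := H k.+1 - Hinf.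
have s0 k : 0 <= s k by rewrite subr_ge0 auglag_ge_inf.
have [K _ Keta] : \forall k \near \oo, ((s k)%:E < eta)%E.
  case: eta eta0 {KL dphi} => [eta||] // eta0; last by apply: nearW => k; rewrite ltry.
  have : s @ \oo --> 0.
    rewrite -(subrr Hinf); apply: cvgB; last exact: cvg_cst.
    by have := auglag_cvg; rewrite -cvg_shiftS.
  by move/cvgr_lt => /(_ eta eta0).
have c0 := descent_rate_gt0; set c := (_ - _) in c0.
exists K, (fun k => C / c * phi (s k)).
have Cc0 : 0 <= C / c by rewrite divr_ge0 // ltW.
have sS k : s k.+1 <= s k by rewrite lerD2r auglag_nonincreasing.
have homo k : (K <= k)%N -> phi (s k.+1) <= phi (s k).
  by move=> Kk; apply: (desingularizing_homo dphi) => //; exact: Keta.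
split=> k Kk; first by rewrite mulr_ge0 //; case: dphi => _ _ + _ _; apply; split=> //; exact: Keta.
  by rewrite ler_wpM2l // homo.
move=> /= Wk; rewrite -mulrBr.
have dec : c * delta k.+1 ^+ 2 <= s k - s k.+1.
  by apply: le_trans (auglag_decrease k.+1) _; rewrite /s opprB addrA subrK.
(* At the limit value the KL inequality says nothing, but then the decrease estimate forces
   [delta k.+1] to vanish. *)
have [sk0|sk] := eqVneq (s k) 0.
  apply: (@le_trans _ _ 0).
    by rewrite -(pmulr_rle0 _ c0); apply: le_trans dec _; rewrite sk0 sub0r oppr_le0.
  by rewrite mulr_ge0 ?block_norm_ge0 // mulr_ge0 // subr_ge0 homo.
have sk_gt0 : 0 < s k by rewrite lt_neqAle eq_sym sk s0.
have := KL (x k.+1, lam k.+1) Wk; rewrite ext; last exact: x_feas.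
rewrite /= lte_fin -subr_gt0 -/(H k.+1) -/(s k) => /(_ sk_gt0).
have -> : (((H k.+1)%:E < Hinf%:E + eta) = ((s k)%:E < eta))%E.
  by rewrite EFinB lteBlDl.
move=> /(_ (Keta _ Kk)) kl.
have [_ _ _ _ /(_ _ sk_gt0 (Keta _ Kk))[_ _ phi'0]] := dphi.
have [v dv vle] := vC k.
(* The distance to the subdifferential is at most the norm of the subgradient [v]. Multiplying by
   the decrease and using concavity of [phi] yields the recursion. *)
have : 1 <= phi^`()%classic (s k) * (C * delta k).
  rewrite -lee_fin; apply: le_trans kl _; rewrite EFinM lee_wpmul2l ?lee_fin ?(ltW phi'0) //.
  apply: (@le_trans _ _ (wnorm v)%:E); last by rewrite lee_fin.
  by apply: ereal_inf_lbound; exists v.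
move=> phi'1; rewrite (_ : C / c * _ * _ = (phi (s k) - phi (s k.+1)) * (C * delta k) / c).
  rewrite ler_pdivlMr // [X in X <= _]mulrC; apply: le_trans dec _.
  have s's : 0 <= s k - s k.+1 by rewrite subr_ge0.
  rewrite -[X in X <= _]mulr1; apply: le_trans (ler_wpM2l s's phi'1) _.
  rewrite mulrA [X in X * _ <= _]mulrC ler_wpM2r ?mulr_ge0 ?block_norm_ge0 //.
  exact: (desingularizing_slope dphi (s0 k.+1) (sS k) sk_gt0 (Keta _ Kk)).
by ring.
Qed.

Lemma increments_summable : exists2 G, 0 <= G & forall t, \sum_(k < t) delta k <= G.
Proof.
have delta0 k : 0 <= delta k by exact: block_norm_ge0.
have [K [psi [psi0 psiS rec]]] := kl_good_ultra delta0 kl_ultra_good.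
have bound := kl_good_bounded delta0 psi0 psiS (fun k Kk => rec k Kk I).
by eexists; [apply: le_trans (bound 0%N); rewrite big_ord0|exact: bound].
Qed.

End admm_descent.

(** * The averaged iterates *)

Section ergodic.
Context {R : realType} {N p : nat} {n : 'I_N -> nat}.
Context {A : forall i, 'M[R]_(p, n i)} {b : 'cV[R]_p}.
Context {X : forall i, set 'cV[R]_(n i)} {f : forall i, 'cV[R]_(n i) -> R}.
Context {gamma : R} {x : nat -> forall i, 'cV[R]_(n i)} {lam : nat -> 'cV[R]_p}.
Context {us : forall i, 'cV[R]_(n i)} {lams : 'cV[R]_p}.
Arguments X : clear implicits.
Arguments f : clear implicits.
Context (X_convex : forall i, convex_set (X i)).
Context (f_convex : forall i, convex_function setT (f i)).
Context (gamma_gt0 : 0 < gamma) (admm : multiblock_ADMM A b X f gamma x lam).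
Context (us_opt : Omega_star A b X f (us, lams)).

Let delta k := block_norm (increment A x k).

(** Per block, the subgradient inequality is combined with the variational inequality; feasibility
    of [us] turns the sum into the residual. *)
Lemma optimal_gap u : (forall i, X i (u i)) ->
  dot lams (residual A b u) <= objective f u - objective f us.
Proof.
move=> Xu; have [_ /= Aus opt] := us_opt.
rewrite /residual -Aus -!sumrB dot_sumr; apply: ler_sum => i _.
have [g [_ sub] opti] := opt i; have := opti _ (Xu i).
have := sub (u i); rewrite /= -EFinD lee_fin => subi.
rewrite dotDr dotNr -dot_mulmx dotC -mulmxBr (dotC (_ *m _)).
by move: subi; rewrite (dotC g); lra.
Qed.

Lemma objective_average t :
  objective f (average x t) <= t.+1%:R^-1 * \sum_(k < t.+1) objective f (x k.+1).
Proof.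
rewrite exchange_big mulr_sumr; apply: ler_sum => i _.
exact: (convex_function_avg (fun k => x k.+1 i) t (@f_convex i)).
Qed.

Lemma residual_average t :
  residual A b (average x t) = t.+1%:R^-1 *: \sum_(k < t.+1) residual A b (x k.+1).
Proof.
rewrite /residual sumrB sumr_const card_ord scalerBr -[b *+ _]scaler_nat scalerA.
rewrite mulVf ?pnatr_eq0 // scale1r; congr (_ - _).
rewrite exchange_big /= scaler_sumr; apply: eq_bigr => i _.
by rewrite -scalemxAr mulmx_sumr.
Qed.

Lemma cross_term_le (M : R) : (forall k i, enorm (x k.+1 i) <= M) ->
  exists2 E, 0 <= E & forall k,
    \sum_i dot (tail_sum (increment A x k) i) (A i *m (us i - x k.+1 i)) <= E * delta k.
Proof.
move=> xM; have /choice[C CP] i : exists C, 0 <= C /\ forall y, enorm (A i *m y) <= C * enorm y.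
  by have [C C0 CP] := mulmx_bounded (A i); exists C.
have b0 i : 0 <= enorm (us i) + M.
  by rewrite addr_ge0 ?enorm_ge0 //; apply: le_trans (xM 0%N i); exact: enorm_ge0.
exists (\sum_i N%:R * (C i * (enorm (us i) + M))) => [|k].
  by apply: sumr_ge0 => i _; rewrite !mulr_ge0 ?ler0n ?(CP i).1.
rewrite mulr_suml; apply: ler_sum => i _; apply: le_trans (cauchy_schwarz _ _) _.
rewrite mulrAC; apply: ler_pM; rewrite ?enorm_ge0 ?enorm_tail_sum //.
apply: le_trans ((CP i).2 _) _; rewrite ler_wpM2l ?(CP i).1 //.
by apply: le_trans (ler_enormB _ _) _; rewrite lerD2l.
Qed.

(** Summing the one-step gaps telescopes the dual distances. The vector [l] stays free so that it
    can later be aligned with the averaged residual. *)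
Lemma ergodic_gap (E : R) l t :
  (forall k, \sum_i dot (tail_sum (increment A x k) i) (A i *m (us i - x k.+1 i))
     <= E * delta k) ->
  t.+1%:R * (objective f (average x t) - objective f us - dot l (residual A b (average x t)))
  <= enorm (l - lam 0%N) ^+ 2 / (2 * gamma) + gamma * E * \sum_(k < t.+1) delta k.
Proof.
move=> EP; have [Xus /= Aus _] := us_opt.
have t0 : t.+1%:R != 0 :> R by rewrite pnatr_eq0.
apply: (@le_trans _ _ (\sum_(k < t.+1) (objective f (x k.+1) - objective f us
    - dot l (residual A b (x k.+1))))).
  rewrite !sumrB sumr_const card_ord -dot_sumr residual_average dotZr !mulrBr.
  rewrite mulVKf // lerD2r [_ * objective f us]mulr_natl lerD2r -ler_pdivlMl ?ltr0n //.
  exact: objective_average.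
have step k : objective f (x k.+1) - objective f us - dot l (residual A b (x k.+1)) <=
    (enorm (l - lam k) ^+ 2 / (2 * gamma) - enorm (l - lam k.+1) ^+ 2 / (2 * gamma))
    + gamma * E * delta k.
  apply: le_trans (admm_gap X_convex f_convex gamma_gt0 admm k l Xus Aus) _.
  by rewrite mulrBl lerD2l -mulrA ler_wpM2l ?(ltW gamma_gt0).
apply: le_trans (ler_sum _ (fun (k : 'I_t.+1) _ => step k)) _.
rewrite big_split /= -mulr_sumr lerD2r.
pose e k := - (enorm (l - lam k) ^+ 2 / (2 * gamma)).
rewrite (eq_bigr (fun k : 'I_t.+1 => e k.+1 - e k)); last first.
  by move=> k _; rewrite /e opprK addrC.
rewrite -(big_mkord xpredT (fun k => e k.+1 - e k)) telescope_sumr //.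
by rewrite /e opprK gerDr oppr_le0 divr_ge0 ?sqr_ge0 // mulr_ge0 // ltW.
Qed.

End ergodic.

(** * Explicit constants for the ergodic bound and the complexity estimate *)

Theorem theorem4p7 (R : realType) (N p : nat) (hN : (3 <= N)%N)
    (n : 'I_N -> nat)
    (A : forall i, 'M[R]_(p, n i)) (b : 'cV[R]_p)
    (X : forall i, set 'cV[R]_(n i)) (f : forall i, 'cV[R]_(n i) -> R)
    (X_closed : forall i, closed (X i))
    (X_convex : forall i, convex_set (X i))
    (f_closed : forall i, closed_function (f i))
    (f_convex : forall i, convex_function setT (f i))
    (Omega_star_neq0 : Omega_star A b X f !=set0)
    (* the last block: A_N = I and X_N = R^(n_N) *)
    (iN : 'I_N) (iN_last : iN.+1 = N)
    (dimN : n iN = p) (AN_id : castmx (erefl p, dimN) (A iN) = 1%:M)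
    (XN_full : X iN = setT)
    (L : R) (L_ge0 : 0 <= L)
    (fN_diff : forall y, differentiable (f iN) y)
    (fN_lip : forall y z,
       enorm (grad (f iN) y - grad (f iN) z) <= L * enorm (y - z))
    (gamma : R) (gamma_gt0 : 0 < gamma) (gamma_gt : Num.sqrt 2 * L < gamma)
    (fstar : 'I_N -> R)
    (f_lb : forall i,
       ((fstar i)%:E <= ereal_inf [set (f i xi)%:E | xi in X i])%E)
    (f_coercive : forall i, i != iN -> coercive (extend (X i) (f i)))
    (KL_auglag :
       KL_function (auglag_ext A b X f gamma) (subdiff_auglag A b X f gamma))
    (x : nat -> forall i, 'cV[R]_(n i)) (lam : nat -> 'cV[R]_p)
    (admm : multiblock_ADMM A b X f gamma x lam)
    (us : forall i, 'cV[R]_(n i)) (lams : 'cV[R]_p)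
    (us_opt : Omega_star A b X f (us, lams)) :
  let rho := enorm lams + 1 in
  (exists D G : R, [/\ 0 < D, 0 < G &
     forall t : nat, (0 < t)%N ->
       0 <= objective f (average x t) - objective f us
            + rho * enorm (residual A b (average x t)) /\
       objective f (average x t) - objective f us
       + rho * enorm (residual A b (average x t))
       <= (rho ^+ 2 + enorm (lam 0%N) ^+ 2) / (gamma * t.+1%:R)
          + gamma / (2 * t.+1%:R) *
            enorm (\sum_(i : 'I_N | (0 < i)%N && (i != iN))
                     A i *m (x 0%N i - us i)
                   + castmx (dimN, erefl 1%N) (x 0%N iN - us iN)) ^+ 2
          + gamma * D * G / t.+1%:R]) /\
  (forall c : R, 0 < c -> exists C : R,
     forall (eps : R) (t : nat), 0 < eps -> c / eps <= t%:R -> (0 < t)%N ->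
       `|objective f (average x t) - objective f us| <= C * eps /\
       enorm (residual A b (average x t)) <= C * eps).
Proof.
move=> rho; have [Xus /= Aus _] := us_opt.
have [AAT ATA] := mulmx_trmx_isometry AN_id.
have f_lb' i y : X i y -> fstar i <= f i y.
  move=> Xy; rewrite -lee_fin; apply: le_trans (f_lb i) _.
  by apply: ereal_inf_lbound; exists y.
(* No block follows the last one, so its tail sum is empty; as its feasible set is the whole space,
   its optimality condition is a plain subgradient inequality. *)
have dual_grad k : (A iN)^T *m lam k.+1 = grad (f iN) (x k.+1 iN).
  apply: subgradient_unique => // y.
  have := admm_ineq X_convex f_convex gamma_gt0 admm k (i := iN) (y := y).
  rewrite XN_full => /(_ I); rewrite /tail_sum big_pred0 => [|j]; last first.
    by rewrite ltnNge -ltnS iN_last ltn_ord.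
  by rewrite scaler0 subr0 dotC dot_mulmx dotC.
(* The starting point is neither feasible nor dually consistent: shift by one. *)
have admmS : multiblock_ADMM A b X f gamma (fun k => x k.+1) (fun k => lam k.+1).
  by move=> k; exact: admm k.+1.
have xS_feas := admm_feasible admm.
have [M _ xM] := primal_bounded X_convex f_convex AAT ATA XN_full L_ge0 fN_diff fN_lip
  gamma_gt0 gamma_gt f_lb' f_coercive admmS xS_feas dual_grad.
have [G0 G0_ge0 G0P] := increments_summable X_convex f_convex X_closed f_closed AAT ATA
  XN_full L_ge0 fN_diff fN_lip gamma_gt0 gamma_gt f_lb' f_coercive KL_auglag admmS
  xS_feas dual_grad.
have [E E0 EP] := cross_term_le (A := A) (us := us) xM.
pose delta0 := block_norm (increment A x 0).
have delta0_ge0 : 0 <= delta0 := block_norm_ge0 _.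
(* Summability is known for the shifted sequence, so the first increment is added separately; the
   final 1 makes [G] positive. *)
pose G := E * (delta0 + G0) + 1.
have G_gt0 : 0 < G by rewrite ltr_wpDl // mulr_ge0 // addr_ge0.
have rho_ge1 : 1 <= rho by rewrite lerDr enorm_ge0.
have rho_gt0 : 0 < rho := lt_le_trans ltr01 rho_ge1.
set Q := enorm (\sum_(i | _) _ + _) ^+ 2.
have Q_ge0 : 0 <= Q := sqr_ge0 _.
pose B := (rho ^+ 2 + enorm (lam 0%N) ^+ 2) / gamma + gamma / 2 * Q + gamma * G.
pose S t := objective f (average x t) - objective f us
            + rho * enorm (residual A b (average x t)).
have lower t : - enorm lams * enorm (residual A b (average x t))
    <= objective f (average x t) - objective f us.
  have avgX i : X i (average x t i).
    exact: (convex_set_avg (u := fun k => x k.+1 i) t (X_convex i)).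
  apply: le_trans (optimal_gap us_opt avgX).
  by have := ler_dot_norm lams (residual A b (average x t)); rewrite ler_norml mulNr => /andP[].
(* The extra 1 in [rho] leaves one full copy of the residual norm after the lower bound. *)
have res_le t : enorm (residual A b (average x t)) <= S t.
  by have := lower t; rewrite /S /rho; lra.
have upper t : S t <= B / t.+1%:R.
  have t0 : 0 < t.+1%:R :> R by rewrite ltr0n.
  set rt := residual A b (average x t).
  (* Opposite to the residual with length [rho], this vector produces the penalty term. If the
     residual is zero, division by zero gives 0 and [l = 0]. *)
  pose l := - (rho / enorm rt) *: rt.
  have dot_l : dot l rt = - (rho * enorm rt).
    have [r0|r0] := eqVneq (enorm rt) 0; first by rewrite (enorm_eq0 r0) dot0r enorm0 mulr0 oppr0.
    by rewrite dotZl -enorm_sqr mulNr expr2 mulrA divfK.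
  have l_le : enorm l <= rho.
    rewrite enormZ normrN ger0_norm ?divr_ge0 ?enorm_ge0 ?(ltW rho_gt0) //.
    have [->|r0] := eqVneq (enorm rt) 0; first by rewrite mulr0 ltW.
    by rewrite divfK.
  have l_dist : enorm (l - lam 0%N) ^+ 2 <= 2 * (rho ^+ 2 + enorm (lam 0%N) ^+ 2).
    apply: (@le_trans _ _ ((rho + enorm (lam 0%N)) ^+ 2)).
      rewrite lerXn2r ?nnegrE ?addr_ge0 ?enorm_ge0 ?(ltW rho_gt0) //.
      by apply: le_trans (ler_enormB _ _) _; rewrite lerD2r.
    by have := sqr_ge0 (rho - enorm (lam 0%N)); lra.
  rewrite ler_pdivlMr // mulrC.
  have := ergodic_gap X_convex f_convex gamma_gt0 admm us_opt l t EP.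
  rewrite dot_l opprK -/(S t) => /le_trans; apply.
  rewrite /B lerD //.
    apply: (@le_trans _ _ ((rho ^+ 2 + enorm (lam 0%N) ^+ 2) / gamma)).
      rewrite (_ : _ / gamma = 2 * (rho ^+ 2 + enorm (lam 0%N) ^+ 2) / (2 * gamma)).
        by rewrite ler_pM2r // invr_gt0 mulr_gt0.
      by field; rewrite gt_eqF.
    by rewrite lerDl mulr_ge0 // divr_ge0 // ltW.
  rewrite -mulrA ler_wpM2l ?(ltW gamma_gt0) // /G.
  apply: (@le_trans _ _ (E * (delta0 + G0))); last by rewrite lerDl.
  by rewrite ler_wpM2l // big_ord_recl lerD2l; exact: G0P.
have S_ge0 t : 0 <= S t by apply: le_trans (res_le t); exact: enorm_ge0.
have B_ge0 : 0 <= B.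
  by have := le_trans (S_ge0 0%N) (upper 0%N); rewrite pmulr_lge0 // invr_gt0.
split.
  (* With [D = 1], the whole constant is carried by [G]. *)
  exists 1, G; split=> // t _; split; first exact: S_ge0.
  apply: le_trans (upper t) _; rewrite /B mulr1 mulrDl [X in X + _ <= _]mulrDl.
  rewrite -[_ / gamma / _]mulrA -invfM -/Q.
  have -> : gamma / 2 * Q / t.+1%:R = gamma / (2 * t.+1%:R) * Q.
    by rewrite [(2 * _)^-1]invfM; ring.
  by [].
(* Since [t.+1 >= c / eps], the bound [B / t.+1] is at most [B / c * eps]; the factor [rho] covers
   the negative side of the objective gap. *)
move=> c c0; exists (rho * B / c) => eps t eps0 c_t t0.
have rate : rho * S t <= rho * B / c * eps.
  rewrite -!mulrA ler_wpM2l ?(ltW rho_gt0) //; apply: le_trans (upper t) _.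
  rewrite ler_wpM2l // mulrC -[leRHS]invrK lef_pV2 ?posrE ?invr_gt0 ?divr_gt0 ?ltr0n //.
  by rewrite invf_div; apply: le_trans c_t _; rewrite ler_nat.
have := lower t; have := res_le t.
have := mulr_ge0 (enorm_ge0 lams) (S_ge0 t).
have := enorm_ge0 (residual A b (average x t)).
have lams0 := enorm_ge0 lams.
have S_le : S t <= rho * S t by rewrite ler_peMl.
move=> r0 lS rS low; split; last exact: le_trans rS (le_trans S_le rate).
apply: le_trans rate; rewrite ler_norml; apply/andP; split.
  have := ler_wpM2l lams0 rS; rewrite /rho; lra.
by apply: le_trans S_le; rewrite /S lerDl mulr_ge0 ?(ltW rho_gt0).
Qed.
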